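(* Let $n\ge 1$, let $H\in C^2(\mathbb{R}^n)$ have positive definite Hessian $H_{pp}(p)$ for every $p\in\mathbb{R}^n$ and satisfy $\lim_{|p|\to\infty} H(p)/|p|=+\infty$. Let $u_T\in \mathrm{Lip}(\mathbb{R}^n)$ and $T>0$. Then the set $I_T(u_T)=\{u_0\in \mathrm{Lip}(\mathbb{R}^n) : S_T^+u_0=u_T\}$ is nonempty if and only if $S_T^+(S_T^-u_T)=u_T$.
   Context: $\mathrm{Lip}(\mathbb{R}^n)$ is the set of (globally) Lipschitz continuous functions $\mathbb{R}^n\to\mathbb{R}$. Viscosity solution: for continuous $F:\mathbb{R}^n\to\mathbb{R}$, a uniformly continuous $u:[0,T]\times\mathbb{R}^n\to\mathbb{R}$ is a viscosity solution of $\partial_t u+F(D_xu)=0$ if for every $\varphi\in C^\infty([0,T]\times\mathbb{R}^n)$ and $(t_0,x_0)\in(0,T)\times\mathbb{R}^n$: $\partial_t\varphi(t_0,x_0)+F(\nabla_x\varphi(t_0,x_0))\le 0$ whenever $(t_0,x_0)$ is a local maximum of $u-\varphi$, and $\ge 0$ whenever it is a local minimum of $u-\varphi$. Backward viscosity solution: $w$ is a backward viscosity solution of $\partial_t w+H(D_xw)=0$ in $[0,T]\times\mathbb{R}^n$ if $v(t,x):=w(T-t,x)$ is a viscosity solution of $\partial_t v-H(D_xv)=0$. For $u_0\in\mathrm{Lip}(\mathbb{R}^n)$, $S_T^+u_0:=u(T,\cdot)\in\mathrm{Lip}(\mathbb{R}^n)$, where $u$ is the unique viscosity solution of $\partial_tu+H(D_xu)=0$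 with $u(0,\cdot)=u_0$. For $u_T\in\mathrm{Lip}(\mathbb{R}^n)$, $S_T^-u_T:=w(0,\cdot)\in\mathrm{Lip}(\mathbb{R}^n)$, where $w$ is the unique backward viscosity solution of $\partial_tw+H(D_xw)=0$ with $w(T,\cdot)=u_T$. With $L(q)=\max_{p\in\mathbb{R}^n}[q\cdot p-H(p)]$, these operators are given by the well-known representation formulas $$S_T^+u_0(x)=\min_{y\in\mathbb{R}^n}\Big[u_0(y)+T\,L\Big(\frac{x-y}{T}\Big)\Big],\qquad S_T^-u_T(x)=\max_{y\in\mathbb{R}^n}\Big[u_T(y)-T\,L\Big(\frac{y-x}{T}\Big)\Big].$$ *)

(* Defs.v *)
From HB Require Import structures.
From mathcomp Require Import all_boot all_order all_algebra.
From mathcomp Require Import all_classical all_reals all_analysis.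

Set Implicit Arguments.
Unset Strict Implicit.
Unset Printing Implicit Defensive.
Import Order.TTheory GRing.Theory Num.Theory numFieldNormedType.Exports.
Local Open Scope classical_set_scope.
Local Open Scope ring_scope.

(* R^n is 'rV[R]_n and space-time is R * 'rV[R]_n.  The norms of MathComp-Analysis
   on these are max norms; Lipschitz and uniform continuity, and superlinearity,
   are the same for them as for the Euclidean norm. *)

(* C^k on a finite-dimensional V: C^(k+1) means Frechet differentiable with a
   C^k derivative, the latter being tested on each v |-> Df(.) v. *)
Fixpoint Ck (R : realType) (V : normedModType R) (k : nat) (f : V -> R) : Prop :=
  match k with
  | 0 => continuous f
  | k'.+1 => (forall x, differentiable f x) /\ forall v, Ck k' ('D_v f)
  end.

Definition smooth (R : realType) (V : normedModType R) (f : V -> R) : Prop :=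
  forall k, Ck k f.

Definition grad (R : realType) (n : nat) (f : 'rV[R]_n -> R) (x : 'rV[R]_n) :
    'rV[R]_n :=
  \row_i 'D_(delta_mx 0 i) f x.

Definition hessian (R : realType) (n : nat) (f : 'rV[R]_n -> R) (x : 'rV[R]_n) :
    'M[R]_n :=
  \matrix_(i, j) 'D_(delta_mx 0 i) ('D_(delta_mx 0 j) f) x.

Definition pos_def (R : realType) (n : nat) (A : 'M[R]_n) : Prop :=
  forall v : 'rV[R]_n, v != 0 -> 0 < (v *m A *m v^T) 0 0.

Definition superlinear (R : realType) (n : nat) (H : 'rV[R]_n -> R) : Prop :=
  forall A : R, exists B : R, forall p, B < `|p| -> A < H p / `|p|.

Definition slab (R : realType) (n : nat) (T : R) : set (R * 'rV[R]_n) :=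
  [set z | 0 <= z.1 <= T].

Definition unif_continuous_on (R : realType) (V : normedModType R) (A : set V)
    (f : V -> R) : Prop :=
  forall e : R, 0 < e -> exists2 d : R, 0 < d &
    forall y z, A y -> A z -> `|y - z| < d -> `|f y - f z| < e.

Definition local_max (R : realType) (V : normedModType R) (f : V -> R) (a : V) :
    Prop :=
  \forall z \near a, f z <= f a.

Definition local_min (R : realType) (V : normedModType R) (f : V -> R) (a : V) :
    Prop :=
  \forall z \near a, f a <= f z.

(* u represents a function on [0, T] x R^n; its values elsewhere are irrelevant.
   Test functions in C^oo([0, T] x R^n) are taken as restrictions of smooth
   functions on R x R^n. *)
Definition viscosity_solution (R : realType) (n : nat) (T : R)
    (F : 'rV[R]_n -> R) (u : R * 'rV[R]_n -> R) : Prop :=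
  unif_continuous_on (slab T) u /\
  forall phi : R * 'rV[R]_n -> R, smooth phi ->
  forall (t0 : R) (x0 : 'rV[R]_n), 0 < t0 < T ->
    let dt := derive1 (fun t => phi (t, x0)) t0 in
    let dx := grad (fun x => phi (t0, x)) x0 in
    (local_max (fun z => u z - phi z) (t0, x0) -> dt + F dx <= 0) /\
    (local_min (fun z => u z - phi z) (t0, x0) -> 0 <= dt + F dx).

Definition backward_viscosity_solution (R : realType) (n : nat) (T : R)
    (H : 'rV[R]_n -> R) (w : R * 'rV[R]_n -> R) : Prop :=
  viscosity_solution T (fun p => - H p) (fun z => w (T - z.1, z.2)).

(* [get] selects the common trace of the solutions of the Cauchy problem; all
   solutions agree on [0, T] x R^n when H and the datum are as in the theorem. *)
Definition Splus (R : realType) (n : nat) (T : R) (H u0 : 'rV[R]_n -> R) :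
    'rV[R]_n -> R :=
  get [set v | exists u, [/\ viscosity_solution T H u,
    (forall x, u (0, x) = u0 x) & (forall x, v x = u (T, x))]].

Definition Sminus (R : realType) (n : nat) (T : R) (H uT : 'rV[R]_n -> R) :
    'rV[R]_n -> R :=
  get [set v | exists w, [/\ backward_viscosity_solution T H w,
    (forall x, w (T, x) = uT x) & (forall x, v x = w (0, x))]].

Definition initial_data (R : realType) (n : nat) (T : R) (H uT : 'rV[R]_n -> R) :
    set ('rV[R]_n -> R) :=
  [set u0 | lipschitz u0 /\ Splus T H u0 = uT].

(* Main.v *)
Require Import Defs.
From HB Require Import structures.
From mathcomp Require Import all_boot all_order all_algebra.
From mathcomp Require Import all_classical all_reals all_analysis.
From mathcomp Require Import ring lra.

Set Implicit Arguments.
Unset Strict Implicit.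
Unset Printing Implicit Defensive.
Import Order.TTheory GRing.Theory Num.Theory numFieldNormedType.Exports.
Local Open Scope classical_set_scope.
Local Open Scope ring_scope.

(* The Hopf-Lax function u(t, x) = inf_q [u0(x - t q) + t L(q)] is a viscosity
   solution, and by the doubling of variables two uniformly continuous solutions
   with the same initial datum agree, so [Splus] is given by the Hopf-Lax formula.
   For [Sminus] apply the same to w |-> -w(T - t, x), a solution for the Hamiltonian
   p |-> H(-p).  Choosing the same q in both formulas yields
   S^- S^+ u0 <= u0 and uT <= S^+ S^- uT.  If S^+ u0 = uT, then
   uT <= S^+ S^- uT = S^+ (S^- S^+ u0) <= S^+ u0 = uT by monotonicity of S^+.
   Conversely S^- uT is Lipschitz, hence an initial datum for uT. *)

(** * Scalar product and differentials *)

(** The main obstacle is uniqueness: [get] may select any trace, so nothing is known about it until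
    two solutions are compared on an unbounded space, with inequalities only at times strictly
    between 0 and T. The doubled functional therefore carries four penalties: k ties the two points
    together, b makes a maximum exist on all of R^n, l leaves a strict gap 2 l once the two
    viscosity inequalities are subtracted, and G keeps the maximum away from T. They are fixed one
    after another, b last because it depends on the modulus of the Hamiltonian near momenta of size
    2 k (A + 1); no parameter is sent to a limit. All jets come from quadratic polynomials, so each
    penalty only has to lie below a parabola. The max norm of ['rV[R]_n] is not differentiable;
    hence points are penalised through [dot] and brought back to the norm by [sqr_normr_le_dot]. *)

Definition dot (R : realType) (n : nat) (x y : 'rV[R]_n) : R :=
  \sum_i x 0 i * y 0 i.

Section dot.
Context {R : realType} {n : nat}.
Implicit Types x y z : 'rV[R]_n.

Lemma dotC x y : dot x y = dot y x.
Proof. by apply: eq_bigr => i _; rewrite mulrC. Qed.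

Lemma dotDl x y z : dot (x + y) z = dot x z + dot y z.
Proof. by rewrite -big_split; apply: eq_bigr => i _; rewrite mxE mulrDl. Qed.

Lemma dotZl (a : R) x y : dot (a *: x) y = a * dot x y.
Proof. by rewrite mulr_sumr; apply: eq_bigr => i _; rewrite mxE mulrA. Qed.

Lemma dotNl x y : dot (- x) y = - dot x y.
Proof. by rewrite -scaleN1r dotZl mulN1r. Qed.

Lemma dotDr x y z : dot z (x + y) = dot z x + dot z y.
Proof. by rewrite dotC dotDl !(dotC z). Qed.

Lemma dotZr (a : R) x y : dot x (a *: y) = a * dot x y.
Proof. by rewrite dotC dotZl (dotC x). Qed.

Lemma dotNr x y : dot x (- y) = - dot x y.
Proof. by rewrite dotC dotNl (dotC x). Qed.

Lemma dotBr x y z : dot z (x - y) = dot z x - dot z y.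
Proof. by rewrite dotDr dotNr. Qed.

Lemma dot0l x : dot 0 x = 0.
Proof. by rewrite -(scale0r 0) dotZl mul0r. Qed.

Lemma normr_coord x i : `|x 0 i| <= `|x|.
Proof.
rewrite -[leRHS]/(mx_norm x) mx_normrE; apply/bigmax_geP; right => /=.
by exists (ord0, i).
Qed.

Lemma normr_coord_attained x : x != 0 -> exists i, `|x| = `|x 0 i|.
Proof.
rewrite -normr_eq0 => x0; have [[j i] /= xi] := mx_norm_neq0 x0.
by exists i; rewrite (ord1 j) in xi.
Qed.

Lemma normr_dot x y : `|dot x y| <= n%:R * `|x| * `|y|.
Proof.
apply: le_trans (ler_norm_sum _ _ _) _.
have -> : n%:R * `|x| * `|y| = \sum_(i < n) `|x| * `|y|.
  by rewrite sumr_const card_ord -mulrA mulr_natl.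
by apply: ler_sum => i _; rewrite normrM ler_pM// normr_coord.
Qed.

Lemma dot_ge0 x : 0 <= dot x x.
Proof. by apply: sumr_ge0 => i _; rewrite -expr2 sqr_ge0. Qed.

(** The max norm is the modulus of one coordinate, and its square is one of the nonnegative summands
    of [dot x x]. *)
Lemma sqr_normr_le_dot x : `|x| ^+ 2 <= dot x x.
Proof.
have [->|/normr_coord_attained[i ->]] := eqVneq x 0.
  by rewrite normr0 expr0n /= dot_ge0.
rewrite -normrX ger0_norm ?sqr_ge0// /dot (bigD1 i)//= expr2 lerDl.
by apply: sumr_ge0 => j _; rewrite -expr2 sqr_ge0.
Qed.

Lemma dot_delta (i : 'I_n) x : dot (delta_mx 0 i) x = x 0 i.
Proof.
rewrite /dot (bigD1 i)//= big1 ?addr0 => [|j ji]; rewrite mxE eqxx ?eqxx/= ?mul1r//.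
by rewrite (negbTE ji) mul0r.
Qed.

End dot.

Section frechet.
Context {R : realType}.

Lemma differentiable_expansion (V : normedModType R) (f : V -> R) (x : V) :
  differentiable f x -> forall e : R, 0 < e ->
  exists2 d : R, 0 < d & forall h : V, `|h| < d ->
    `|f (x + h) - f x - 'd f x h| <= e * `|h|.
Proof.
move=> dfx e e0; have /diff_locally := dfx; set k := 'o _ => fE.
have /(littleoP [littleo of k]) /nbhs_ballP[d /= d0 kd] := e0.
exists d => // h hd.
have -> : f (x + h) = f x + 'd f x h + k h.
  by have /(congr1 (@^~ h)) /= := fE; rewrite addrC.
have -> : f x + 'd f x h + k h - f x - 'd f x h = k h by ring.
by apply: kd; rewrite -ball_normE /= sub0r normrN.
Qed.

Lemma linear_rowE n (f : {linear 'rV[R]_n -> R}) (x : 'rV[R]_n) :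
  f x = \sum_i x 0 i * f (delta_mx 0 i).
Proof.
rewrite [in LHS](row_sum_delta x) linear_sum; apply: eq_bigr => i _.
by rewrite linearZ.
Qed.

Lemma diff_row n (f : 'rV[R]_n -> R) (x v : 'rV[R]_n) :
  differentiable f x -> 'd f x v = dot v (grad f x).
Proof.
move=> dfx; rewrite linear_rowE; apply: eq_bigr => i _.
by rewrite mxE deriveE.
Qed.

(** Viscosity inequalities speak of partial derivatives, whereas first-order expansions along a
    space-time direction need the joint differential; this is the bridge. *)
Lemma diff_space_time n (phi : R * 'rV[R]_n -> R) (t : R) (x : 'rV[R]_n)
    (s : R) (v : 'rV[R]_n) :
  differentiable phi (t, x) ->
  'd phi (t, x) (s, v) = s * derive1 (fun t => phi (t, x)) t
                         + dot v (grad (fun x => phi (t, x)) x).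
Proof.
move=> dphi.
have dt : derive1 (fun t => phi (t, x)) t = 'd phi (t, x) (1, 0).
  rewrite derive1E -deriveE// /derive.
  set f := (X in X @ _); set g := (X in _ = lim (X @ _)).
  suff -> : f = g by [].
  apply/funext => h; rewrite /f /g /=.
  by rewrite -[X in _ = _ *: (phi X - _)]/(h *: 1 + t, h *: 0 + x) scaler0 add0r.
have dx i : grad (fun x => phi (t, x)) x 0 i = 'd phi (t, x) (0, delta_mx 0 i).
  rewrite mxE -deriveE// /derive.
  set f := (X in X @ _); set g := (X in _ = lim (X @ _)).
  suff -> : f = g by [].
  apply/funext => h; rewrite /f /g /=.
  rewrite -[X in _ = _ *: (phi X - _)]/(h *: 0 + t, h *: delta_mx 0 i + x).
  by rewrite scaler0 add0r.
have -> : (s, v) = s *: ((1, 0) : R * 'rV[R]_n) + (0, v).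
  by rewrite -[RHS]/(s * 1 + 0, s *: 0 + v) scaler0 add0r addr0 mulr1.
rewrite linearD linearZ dt; congr (_ + _).
have lin2 : linear (fun w : 'rV[R]_n => 'd phi (t, x) (0, w)).
  move=> a u w; rewrite -linearZ -linearD.
  by rewrite -[X in _ = 'd phi (t, x) X]/(a * 0 + 0, a *: u + w) mulr0 addr0.
pose l2 : {linear 'rV[R]_n -> R} :=
  HB.pack (fun w : 'rV[R]_n => 'd phi (t, x) (0, w)) (GRing.isLinear.Build _ _ _ _ _ lin2).
rewrite -[LHS]/(l2 v) linear_rowE; apply: eq_bigr => i _.
by rewrite dx.
Qed.

End frechet.

(** * Convexity of [H] *)

Lemma lipschitzP (R : realType) (V : normedModType R) (f : V -> R) :
  lipschitz f <->
  exists2 k : R, 0 <= k & forall x y, `|f x - f y| <= k * `|x - y|.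
Proof.
split=> [[M [_ fM]]|[k k0 fk]].
  exists (`|M| + 1); first by rewrite addr_ge0.
  have M1 : M < `|M| + 1 by rewrite (le_lt_trans (ler_norm M))// ltrDl.
  by move=> x y; exact: (fM _ M1 (x, y)).
exists k; split; first exact: ger0_real.
move=> M kM [x y] _ /=; apply: le_trans (fk x y) _.
by rewrite ler_wpM2r// ltW.
Qed.

Section tangent.
Context {R : realType}.

Lemma is_derive_line (V : normedModType R) (f : V -> R) (x v : V) (s : R) :
  differentiable f (x + s *: v) ->
  is_derive s 1 (fun s : R => f (x + s *: v)) ('D_v f (x + s *: v)).
Proof.
move=> df; have dv : derivable f (x + s *: v) v by apply: diff_derivable.
have E : (fun h : R => h^-1 *: (((fun s : R => f (x + s *: v)) \o shift s) (h *: 1)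
             - f (x + s *: v))) =
         (fun h => h^-1 *: ((f \o shift (x + s *: v)) (h *: v) - f (x + s *: v))).
  apply/funext => h /=; congr (_ *: (f _ - _)).
  by rewrite scalerDl [h%:A]mulr1 addrCA.
by split; rewrite /derivable /derive E.
Qed.

Lemma line_mean_value (V : normedModType R) (f : V -> R) (x v : V) (s : R) :
  (forall y, differentiable f y) -> 0 < s ->
  exists2 c : R, 0 < c < s & f (x + s *: v) - f x = 'D_v f (x + c *: v) * s.
Proof.
move=> df s0.
have [||c cs] := MVT s0 (f := fun s => f (x + s *: v)) (df := fun s => 'D_v f (x + s *: v)).
- by move=> r _; apply: is_derive_line.
- apply: continuous_subspaceT => r.
  apply: differentiable_continuous; apply/derivable1_diffP.
  by have [] := is_derive_line (df (x + r *: v)).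
- by rewrite scale0r addr0 subr0; exists c => //; move: cs; rewrite in_itv.
Qed.

Lemma derive2_hessian n (H : 'rV[R]_n -> R) (p v : 'rV[R]_n) :
  Ck 2 H -> 'D_v ('D_v H) p = (v *m hessian H p *m v^T) 0 0.
Proof.
move=> [dH d2H].
have dD w : differentiable ('D_w H) p by have [+ _] := d2H w; apply.
have HE : 'D_v H = \sum_j v 0 j *: 'D_(delta_mx 0 j) H.
  apply/funext => y; rewrite deriveE// diff_row// fct_sumE.
  by apply: eq_bigr => j _; rewrite mxE.
rewrite deriveE// diff_row// /dot.
rewrite -mulmxA mxE; apply: eq_bigr => i _; congr (_ * _).
rewrite !mxE HE derive_sum; last first.
  by move=> j; apply/derivableZ/diff_derivable.
by apply: eq_bigr => j _; rewrite !mxE deriveZ 1?mulrC//; apply/diff_derivable.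
Qed.

(** Two mean values along the segment: the increment of H is ['D_v H] at an intermediate point, and
    ['D_v H] has not decreased on the way there because its own derivative is the Hessian form at
    v. *)
Lemma pos_def_hessian_tangent n (H : 'rV[R]_n -> R) (p p' : 'rV[R]_n) :
  Ck 2 H -> (forall p, pos_def (hessian H p)) ->
  H p + dot (grad H p) (p' - p) <= H p'.
Proof.
move=> C2 pd; have [dH d2H] := C2; set v := p' - p.
have [c c1] := line_mean_value p v dH ltr01.
have -> : p + 1 *: v = p' by rewrite scale1r addrC subrK.
rewrite mulr1 => HE.
have [|d dc D2E] := line_mean_value p v (f := 'D_v H) _ (proj1 (andP c1)).
  by have [] := d2H v.
rewrite -lerBrDl HE dotC -diff_row// -deriveE// -subr_ge0 D2E.
case/andP: c1 => c0 _; rewrite mulr_ge0 ?(ltW c0)// derive2_hessian//.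
have [->|v0] := eqVneq v 0; first by rewrite !mul0mx mxE.
by rewrite ltW// pd.
Qed.

End tangent.

(** * Legendre transform and the Hopf-Lax formula *)

Definition legendre (R : realType) (n : nat) (H : 'rV[R]_n -> R) (q : 'rV[R]_n) : R :=
  sup (range (fun p => dot p q - H p)).

(** The interface between the Legendre transform and the Hopf-Lax formula. [fenchel_attained] drives
    the subsolution inequality, [fenchel_young] the supersolution inequality, [fenchel_convex] the
    dynamic programming step, and [fenchel_coercive] the finiteness of the infimum. The list is
    stable under a change of sign of p and q, so the backward problem needs no second theory. *)
Record fenchel_pair (R : realType) (n : nat) (H L : 'rV[R]_n -> R) : Prop := {
  fenchel_young : forall p q, dot p q <= H p + L q;
  fenchel_attained : forall p, exists q, dot p q = H p + L q;
  fenchel_convex : forall (a : R) q q', 0 <= a <= 1 ->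
    L (a *: q + (1 - a) *: q') <= a * L q + (1 - a) * L q';
  fenchel_coercive : forall K : R, 0 <= K ->
    exists C : R, forall q, K * `|q| - C <= L q
}.

Lemma fenchel_pairN (R : realType) n (H L : 'rV[R]_n -> R) :
  fenchel_pair H L -> fenchel_pair (fun p => H (- p)) (fun q => L (- q)).
Proof.
move=> [FY Fa Fc Fi]; split.
- by move=> p q; have := FY (- p) (- q); rewrite dotNl dotNr opprK.
- by move=> p; have [q] := Fa (- p); exists (- q); rewrite dotNr -dotNl opprK.
- by move=> a q q' /(Fc _ (- q) (- q')); rewrite opprD -!scalerN.
- move=> K /Fi[C CL]; exists C => q; by have := CL (- q); rewrite normrN.
Qed.

Section legendre.
Context {R : realType} {n : nat}.
Variables (H : 'rV[R]_n -> R).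
Hypothesis H_tangent : forall p, exists q, forall p', H p + dot q (p' - p) <= H p'.
Hypothesis H_super : superlinear H.

(** For large p, superlinearity with slope n |q| beats the scalar product (n is the price of the max
    norm). On the remaining ball of radius |B| the supporting hyperplane at 0 bounds H from
    below. *)
Lemma legendre_has_ubound q : has_ubound (range (fun p => dot p q - H p)).
Proof.
have [q0 H0] := H_tangent 0.
have [B HB] := H_super (n%:R * `|q|).
exists (Num.max 0 (n%:R * `|q| * `|B| + n%:R * `|q0| * `|B| - H 0)) => _ [p _ <-].
have dpq : dot p q <= n%:R * `|q| * `|p|.
  by rewrite dotC (le_trans (ler_norm _))// normr_dot.
rewrite le_max; have [pB|Bp] := leP `|p| `|B|; apply/orP; [right|left].
  have := H0 p; rewrite subr0 => Hp.
  have dq : - dot q0 p <= n%:R * `|q0| * `|p|.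
    by rewrite (le_trans (ler_norm _))// normrN normr_dot.
  have e1 : n%:R * `|q| * `|p| <= n%:R * `|q| * `|B| by rewrite ler_wpM2l.
  have e2 : n%:R * `|q0| * `|p| <= n%:R * `|q0| * `|B| by rewrite ler_wpM2l.
  by lra.
have p0 : 0 < `|p| by rewrite (le_lt_trans _ Bp).
have := HB p (le_lt_trans (ler_norm B) Bp).
rewrite ltr_pdivlMr// => Hp; by lra.
Qed.

Lemma legendre_ge p q : dot p q - H p <= legendre H q.
Proof.
by apply: ub_le_sup; [exact: legendre_has_ubound | exists p].
Qed.

Lemma legendre_le q c : (forall p, dot p q - H p <= c) -> legendre H q <= c.
Proof.
move=> Hc; apply: ge_sup; first by exists (dot 0 q - H 0); exists 0.
by move=> _ [p _ <-].
Qed.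

Lemma legendre_fenchel_pair : fenchel_pair H (legendre H).
Proof.
split.
- by move=> p q; have := legendre_ge p q; lra.
(* A subgradient q of H at p makes p a maximiser in the definition of [legendre H q]. *)
- move=> p; have [q Hq] := H_tangent p; exists q.
  suff : legendre H q <= dot p q - H p by have := legendre_ge p q; lra.
  apply: legendre_le => p'; have := Hq p'.
  by rewrite dotBr !(dotC q); lra.
- move=> a q q' /andP[a0 a1]; apply: legendre_le => p.
  rewrite dotDr !dotZr.
  have e1 := ler_wpM2l a0 (legendre_ge p q).
  have b0 : 0 <= 1 - a by lra.
  have e2 := ler_wpM2l b0 (legendre_ge p q').
  by lra.
- move=> K K0.
  (* Test the supremum at p = K e_i or -K e_i, where i is the coordinate carrying the max norm of q
     and the sign is that of q_i: the scalar product is then K |q|. Only finitely many values of H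
     occur, and C dominates them all. *)
  pose e i : 'rV[R]_n := delta_mx 0 i.
  pose c i := `|H (K *: e i)| + `|H (- K *: e i)|.
  exists (`|H 0| + \sum_i c i) => q.
  have c0 : 0 <= \sum_i c i by apply: sumr_ge0 => i _; rewrite addr_ge0.
  have [->|/normr_coord_attained[i ->]] := eqVneq q 0.
    have := legendre_ge 0 0; rewrite dot0l normr0 mulr0.
    by have := ler_norm (H 0); lra.
  have ci : c i <= \sum_i c i.
    by rewrite (bigD1 i)//= lerDl sumr_ge0// => j _; rewrite addr_ge0.
  have H0 := normr_ge0 (H 0).
  rewrite /c in ci; have [qi|qi] := leP 0 (q 0 i).
    rewrite ger0_norm//; have := legendre_ge (K *: e i) q.
    rewrite dotZl dot_delta.
    have := ler_norm (H (K *: e i)); have := normr_ge0 (H (- K *: e i)); lra.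
  rewrite ltr0_norm//; have := legendre_ge (- K *: e i) q.
  rewrite dotZl dot_delta.
  have := ler_norm (H (- K *: e i)); have := normr_ge0 (H (K *: e i)); lra.
Qed.

End legendre.

(* Parametrised by the velocity q = (x - y) / t, so that t = 0 gives back u0. *)
Definition hopf_lax (R : realType) (n : nat) (L u0 : 'rV[R]_n -> R)
    (z : R * 'rV[R]_n) : R :=
  inf (range (fun q => u0 (z.2 - z.1 *: q) + z.1 * L q)).

Section hopf_lax.
Context {R : realType} {n : nat}.
Variables (H L u0 : 'rV[R]_n -> R) (K : R).
Hypothesis HL : fenchel_pair H L.
Hypothesis K0 : 0 <= K.
Hypothesis u0K : forall x y, `|u0 x - u0 y| <= K * `|x - y|.

Local Notation u := (hopf_lax L u0).

Lemma lipschitz_le (x y : 'rV[R]_n) : u0 x <= u0 y + K * `|x - y|.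
Proof. by have := u0K x y; rewrite ler_norml => /andP[_]; lra. Qed.

Lemma hopf_lax_has_lbound (t : R) (x : 'rV[R]_n) : 0 <= t ->
  has_lbound (range (fun q => u0 (x - t *: q) + t * L q)).
Proof.
move=> t0; have [C LC] := fenchel_coercive HL K0.
exists (u0 x - t * C) => _ [q _ <-].
have := lipschitz_le x (x - t *: q).
rewrite subKr normrZ ger0_norm// => e1.
by have := ler_wpM2l t0 (LC q); lra.
Qed.

Lemma hopf_lax_le (t : R) (x q : 'rV[R]_n) : 0 <= t -> u (t, x) <= u0 (x - t *: q) + t * L q.
Proof.
by move=> t0; apply: ge_inf; [exact: hopf_lax_has_lbound | exists q].
Qed.

Lemma hopf_lax_ge (t : R) (x : 'rV[R]_n) (c : R) :
  (forall q, c <= u0 (x - t *: q) + t * L q) -> c <= u (t, x).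
Proof.
move=> uc; apply: lb_le_inf; first by exists (u0 (x - t *: 0) + t * L 0); exists 0.
by move=> _ [q _ <-].
Qed.

Lemma hopf_lax_adherent (t : R) (x : 'rV[R]_n) (e : R) : 0 <= t -> 0 < e ->
  exists q, u0 (x - t *: q) + t * L q < u (t, x) + e.
Proof.
move=> t0 e0.
have [|_ [q _ <-] qe] :=
    inf_adherent e0 (E := range (fun q => u0 (x - t *: q) + t * L q)).
  split; last exact: hopf_lax_has_lbound.
  by exists (u0 (x - t *: 0) + t * L 0); exists 0.
by exists q.
Qed.

Lemma hopf_lax0 (x : 'rV[R]_n) : u (0, x) = u0 x.
Proof.
apply/eqP; rewrite eq_le; apply/andP; split.
  by have := hopf_lax_le x 0 (lexx 0); rewrite scale0r subr0 mul0r addr0.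
by apply: hopf_lax_ge => q; rewrite scale0r subr0 mul0r addr0.
Qed.

Lemma hopf_lax_space (t : R) (x y : 'rV[R]_n) : 0 <= t ->
  `|u (t, x) - u (t, y)| <= K * `|x - y|.
Proof.
move=> t0.
have W (a b : 'rV[R]_n) : u (t, a) <= u (t, b) + K * `|a - b|.
  rewrite -lerBlDr; apply: hopf_lax_ge => q.
  have := hopf_lax_le a q t0; have := lipschitz_le (a - t *: q) (b - t *: q).
  by rewrite opprB addrA subrK; lra.
by rewrite ler_norml; have := W x y; have := W y x; rewrite (distrC y x); lra.
Qed.

(** Half of the dynamic programming principle. Velocity q' up to time s followed by q up to time t
    has mean velocity a q' + (1 - a) q with a = s / t, and convexity bounds the cost of the straight
    path by that of the broken one. *)
Lemma hopf_lax_step (s t : R) (x q : 'rV[R]_n) : 0 <= s <= t ->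
  u (t, x) <= u (s, x - (t - s) *: q) + (t - s) * L q.
Proof.
move=> /andP[s0 st]; have [t0|t0] := leP t 0.
  have -> : s = t by lra.
  by rewrite subrr scale0r mul0r subr0 addr0.
rewrite -lerBlDr; apply: hopf_lax_ge => q'; rewrite lerBlDr.
pose a := s / t.
have a01 : 0 <= a <= 1 by rewrite divr_ge0 ?(ltW t0)//= ler_pdivrMr// mul1r.
have ta : t * a = s by rewrite mulrC divfK// gt_eqF.
have tb : t * (1 - a) = t - s by rewrite mulrBr mulr1 ta.
clearbody a.
apply: le_trans (hopf_lax_le x (a *: q' + (1 - a) *: q) (ltW t0)) _.
rewrite scalerDr !scalerA ta tb (addrC (s *: _)) opprD addrA.
have := ler_wpM2l (ltW t0) (fenchel_convex HL q' q a01).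
by rewrite mulrDr !mulrA ta tb; lra.
Qed.

Lemma hopf_lax_time : exists2 C : R, 0 <= C & forall (s t : R) (x : 'rV[R]_n), 0 <= s <= t ->
  `|u (t, x) - u (s, x)| <= C * (t - s).
Proof.
have [C LC] := fenchel_coercive HL K0.
exists (`|C| + `|L 0|); first by rewrite addr_ge0.
move=> s t x /[dup] st /andP[s0 st'].
have ts : 0 <= t - s by lra.
have t0 : 0 <= t by lra.
have eL := ler_wpM2l ts (ler_norm (L 0)).
have eC := ler_wpM2l ts (ler_norm C).
have eL' := mulr_ge0 ts (normr_ge0 (L 0)).
have eC' := mulr_ge0 ts (normr_ge0 C).
rewrite ler_norml; apply/andP; split; last first.
  by have := hopf_lax_step x 0 st; rewrite scaler0 subr0; lra.
(* Use the same q at time s from x - (t - s) q, so that the foot x - t q is unchanged. Moving back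
   to x loses at most K (t - s) |q|, which the coercivity of L with slope K pays for up to C (t -
   s). *)
suff : u (s, x) - (t - s) * C <= u (t, x) by lra.
apply: hopf_lax_ge => q.
have h1 := hopf_lax_le (x - (t - s) *: q) q s0.
rewrite -addrA -opprD -scalerDl subrK in h1.
have := hopf_lax_space x (x - (t - s) *: q) s0.
rewrite subKr normrZ ger0_norm// => h2.
have := le_trans (ler_norm _) h2.
have := ler_wpM2l ts (LC q).
by lra.
Qed.

End hopf_lax.

(** * The Hopf-Lax function is a viscosity solution *)

Lemma norm_pair_le (R : realType) (V W : normedModType R) (x : V) (y : W) (c : R) :
  (`|(x, y)| <= c) = (`|x| <= c) && (`|y| <= c).
Proof. by rewrite prod_normE ge_max. Qed.

Lemma norm_pair_lt (R : realType) (V W : normedModType R) (x : V) (y : W) (c : R) :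
  (`|(x, y)| < c) = (`|x| < c) && (`|y| < c).
Proof. by rewrite prod_normE gt_max. Qed.

Lemma near_translate (R : realType) (V : normedModType R) (P : V -> Prop) (a : V) :
  (\forall z \near a, P z) <->
  exists2 d : R, 0 < d & forall h, `|h| < d -> P (a + h).
Proof.
split=> [/nbhs_ballP[d /= d0 dP]|[d d0 dP]].
  exists d => // h hd; apply: dP; rewrite -ball_normE /=.
  by rewrite opprD addrA subrr sub0r normrN.
apply/nbhs_ballP; exists d => // z; rewrite -ball_normE /= => az.
by rewrite -(subrK a z) addrC; apply: dP; rewrite distrC.
Qed.

Section hopf_lax_viscosity.
Context {R : realType} {n : nat}.
Variables (H L u0 : 'rV[R]_n -> R) (K T : R).
Hypothesis HL : fenchel_pair H L.
Hypothesis K0 : 0 <= K.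
Hypothesis u0K : forall x y, `|u0 x - u0 y| <= K * `|x - y|.

Local Notation u := (hopf_lax L u0).

Lemma hopf_lax_unif_continuous : unif_continuous_on (slab T) u.
Proof.
have [C C0 uC] := hopf_lax_time HL K0 u0K.
have CK : 0 < C + K + 1 by rewrite ltr_wpDl// addr_ge0.
move=> e e0; pose d := e / (C + K + 1).
have d0 : 0 < d by exact: divr_gt0.
have de : d * (C + K + 1) = e by rewrite /d divfK// gt_eqF.
exists d => //.
have W (t : R) (x : 'rV[R]_n) (s : R) (y : 'rV[R]_n) : 0 <= s <= t -> `|(t, x) - (s, y)| < d ->
    `|u (t, x) - u (s, y)| < e.
  move=> /[dup] st /andP[s0 st'].
  rewrite -[(t, x) - (s, y)]/(t - s, x - y) norm_pair_lt.
  have := uC s t x st; have := hopf_lax_space HL K0 u0K x y s0.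
  move=> h1 h2 /andP[h3 h4].
  have -> : u (t, x) - u (s, y) = (u (t, x) - u (s, x)) + (u (s, x) - u (s, y)).
    by rewrite addrA subrK.
  apply: le_lt_trans (ler_normD _ _) _.
  rewrite (ger0_norm (_ : 0 <= t - s)) in h3; last by lra.
  have h5 := ler_wpM2l C0 (ltW h3).
  have h6 := ler_wpM2l K0 (ltW h4).
  by lra.
move=> [t x] [s y] /= /andP[t0 _] /andP[s0 _] h.
have [st|/ltW st] := leP s t; first by apply: W => //; rewrite s0.
by rewrite distrC; apply: W; rewrite ?t0// distrC.
Qed.

(** Go back in time along the velocity q optimal for the momentum p. Dynamic programming lets u grow
    by at most h L(q), while phi grows at rate a + p.q = (a + H(p)) + L(q); a positive a + H(p)
    contradicts the maximum. *)
Lemma hopf_lax_subsolution (phi : R * 'rV[R]_n -> R) (t : R) (x : 'rV[R]_n) :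
  differentiable phi (t, x) -> 0 < t ->
  local_max (fun z => u z - phi z) (t, x) ->
  derive1 (fun t => phi (t, x)) t + H (grad (fun x => phi (t, x)) x) <= 0.
Proof.
move=> dphi t0 /near_translate[d d0 umax].
set a := derive1 _ _; set p := grad _ _.
have [q pq] := fenchel_attained HL p.
rewrite leNgt; apply/negP; set e := _ + _ => e0.
have Q0 : 0 < 1 + `|q| by rewrite ltr_pwDl.
(* The increment k below has norm at most h (1 + |q|), so this tolerance makes the Taylor remainder
   at most h e / 2, half of the gap h e. *)
have [|d' d'0 dE] := differentiable_expansion dphi (e := e / 2 / (1 + `|q|)).
  by rewrite !divr_gt0.
pose m := Num.min t (Num.min (d / (1 + `|q|)) (d' / (1 + `|q|))).
have m0 : 0 < m by rewrite !lt_min t0 !divr_gt0.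
pose h := m / 2; have h0 : 0 < h by rewrite divr_gt0.
have hm : h < m by rewrite /h; lra.
clearbody h.
move: (hm); rewrite !lt_min => /and3P[ht]; rewrite !ltr_pdivlMr// => hd hd'.
pose k : R * 'rV[R]_n := (- h, - (h *: q)).
have kh : `|k| <= h * (1 + `|q|).
  rewrite norm_pair_le !normrN (normrZ h q) gtr0_norm// mulrDr mulr1.
  by rewrite lerDl lerDr (ltW h0) mulr_ge0// ltW.
have := umax k (le_lt_trans kh hd).
have := dE k (le_lt_trans kh hd').
rewrite diff_space_time// -/a -/p dotNl dotZl (dotC q) pq.
have -> : (t, x) + k = (t - h, x - h *: q) by [].
have := hopf_lax_step HL K0 u0K x q (s := t - h) (t := t).
rewrite subKr => /(_ _)/wrap[]; first by apply/andP; split; lra.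
have ke : e / 2 / (1 + `|q|) * `|k| <= e / 2 * h.
  rewrite -mulrA ler_wpM2l//; first by rewrite ltW// divr_gt0.
  by rewrite mulrC ler_pdivrMr.
move=> h1 /le_trans/(_ ke); rewrite ler_norml => /andP[_ h2] h3.
have he : h * e = h * a + h * H p by rewrite mulrDr.
have := mulr_gt0 h0 e0.
by clearbody e; lra.
Qed.

(** Coercivity is used with slope K + 1: K absorbs the variation of u0 along t q, and the spare unit
    bounds t |q|. *)
Lemma hopf_lax_near_minimizer_bounded (t : R) (x : 'rV[R]_n) : 0 < t ->
  exists2 Q : R, 0 <= Q & forall q,
    u0 (x - t *: q) + t * L q < u (t, x) + 1 -> `|q| <= Q.
Proof.
move=> t0; have K1 : 0 <= K + 1 by rewrite addr_ge0.
have [C LC] := fenchel_coercive HL K1.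
exists ((t * `|C| + `|u (t, x) + 1 - u0 x|) / t).
  by rewrite divr_ge0 ?(ltW t0)// addr_ge0// mulr_ge0// ltW.
move=> q h; rewrite ler_pdivlMr//.
have := lipschitz_le u0K x (x - t *: q).
rewrite subKr normrZ gtr0_norm// => h1.
have := ler_wpM2l (ltW t0) (LC q).
have := ler_wpM2l (ltW t0) (ler_norm C).
have := ler_norm (u (t, x) + 1 - u0 x).
by nra.
Qed.

(* Near-minimizers with an error small compared with the time step h suffice, which spares
   the semicontinuity of L; they stay bounded as h goes to 0. *)
Lemma hopf_lax_supersolution (phi : R * 'rV[R]_n -> R) (t : R) (x : 'rV[R]_n) :
  differentiable phi (t, x) -> 0 < t ->
  local_min (fun z => u z - phi z) (t, x) ->
  0 <= derive1 (fun t => phi (t, x)) t + H (grad (fun x => phi (t, x)) x).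
Proof.
move=> dphi t0 /near_translate[d d0 umin].
set a := derive1 _ _; set p := grad _ _.
have [Q Q0 uQ] := hopf_lax_near_minimizer_bounded x t0.
rewrite leNgt; apply/negP => e0; pose e := - (a + H p).
have {}e0 : 0 < e by rewrite oppr_gt0.
have {}Q0 : 0 < 1 + Q by rewrite ltr_pwDl.
have [|d' d'0 dE] := differentiable_expansion dphi (e := e / 4 / (1 + Q)).
  by rewrite !divr_gt0.
(* The bound 4 / e makes the minimisation error h e / 4 smaller than 1, so that Q applies. This
   error and the Taylor remainder h e / 4 add up to h e / 2, which is less than h e. *)
pose m := Num.min (Num.min t (4 / e)) (Num.min (d / (1 + Q)) (d' / (1 + Q))).
have m0 : 0 < m by rewrite !lt_min t0 !divr_gt0.
pose h := m / 2; have h0 : 0 < h by rewrite divr_gt0.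
have hm : h < m by rewrite /h; lra.
clearbody h.
move: (hm); rewrite !lt_min => /andP[/andP[ht]]; rewrite !ltr_pdivlMr// => he /andP[hd hd'].
have he0 : 0 < h * e / 4 by rewrite divr_gt0// mulr_gt0.
have [q uq] := hopf_lax_adherent HL K0 u0K x (ltW t0) he0.
have qQ : `|q| <= Q by apply: uQ; lra.
pose k : R * 'rV[R]_n := (- h, - (h *: q)).
have kh : `|k| <= h * (1 + Q).
  rewrite norm_pair_le !normrN (normrZ h q) gtr0_norm// mulrDr mulr1.
  have h3 := ler_wpM2l (ltW h0) qQ.
  have h4 := mulr_ge0 (ltW h0) (le_trans (normr_ge0 q) qQ).
  by apply/andP; split; lra.
have := umin k (le_lt_trans kh hd).
have := dE k (le_lt_trans kh hd').
rewrite diff_space_time// -/a -/p dotNl dotZl (dotC q).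
have -> : (t, x) + k = (t - h, x - h *: q) by [].
have th : 0 <= t - h by lra.
have := hopf_lax_le HL K0 u0K (x - h *: q) q th.
(* Keeping the velocity q from the earlier point leads to the same foot x - t q, so only the cost h
   L(q) is saved. *)
have -> : x - h *: q - (t - h) *: q = x - t *: q.
  by rewrite -addrA -opprD -scalerDl (addrC h) subrK.
have ke : e / 4 / (1 + Q) * `|k| <= e / 4 * h.
  rewrite -mulrA ler_wpM2l//; first by rewrite ltW// divr_gt0.
  by rewrite mulrC ler_pdivrMr.
move=> h1 /le_trans/(_ ke); rewrite ler_norml => /andP[h2 _] h3.
have := ler_wpM2l (ltW h0) (fenchel_young HL p q).
have eh : h * e = - (h * a) - h * H p by rewrite mulrN mulrDr opprD.
have := mulr_gt0 h0 e0.
by clearbody e; lra.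
Qed.

Lemma hopf_lax_viscosity_solution : viscosity_solution T H u.
Proof.
split; first exact: hopf_lax_unif_continuous.
move=> phi /(_ 1%N)[dphi _] t x /andP[t0 _] /=; split.
  exact: hopf_lax_subsolution.
exact: hopf_lax_supersolution.
Qed.

End hopf_lax_viscosity.

(** * Smooth paraboloids as test functions *)

Section Ck.
Context {R : realType} {V : normedModType R}.
Implicit Types (f g : V -> R) (k : nat).

Lemma CkW k f : Ck k.+1 f -> Ck k f.
Proof.
elim: k f => [f [df _] x|k IH f [df Df]]; first exact/differentiable_continuous.
by split => // v; apply: IH; exact: Df.
Qed.

Lemma Ck_cst k (c : R) : Ck k (fun _ : V => c).
Proof.
elim: k c => [c|k IH c]; first exact: cst_continuous.
split=> [x|v]; first exact: differentiable_cst.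
have -> : 'D_v (fun _ : V => c) = fun _ => 0 by apply/funext => x; rewrite derive_cst.
exact: IH.
Qed.

Lemma Ck_linear k (f : {linear V -> R}) : continuous f -> Ck k f.
Proof.
move=> cf; case: k => [//|k]; split=> [x|v]; first exact: linear_differentiable.
have -> : 'D_v f = fun _ => f v.
  by apply/funext => x; rewrite deriveE ?diff_lin//; apply: linear_differentiable.
exact: Ck_cst.
Qed.

Lemma CkD k f g : Ck k f -> Ck k g -> Ck k (fun z => f z + g z).
Proof.
elim: k f g => [f g cf cg x|k IH f g [df Df] [dg Dg]]; first exact: (cvgD (cf x) (cg x)).
split=> [x|v]; first exact: differentiableD.
have -> : 'D_v (fun z => f z + g z) = fun z => 'D_v f z + 'D_v g z.
  by apply/funext => x; rewrite deriveD//; exact: diff_derivable.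
by apply: IH; [exact: Df|exact: Dg].
Qed.

Lemma CkM k f g : Ck k f -> Ck k g -> Ck k (fun z => f z * g z).
Proof.
elim: k f g => [f g cf cg x|k IH f g /[dup] Cf [df Df] /[dup] Cg [dg Dg]].
  exact: (cvgM (cf x) (cg x)).
split=> [x|v]; first exact: differentiableM.
have -> : 'D_v (fun z => f z * g z) = fun z => f z * 'D_v g z + g z * 'D_v f z.
  by apply/funext => x; rewrite deriveM//; exact: diff_derivable.
apply: CkD; apply: IH; [exact: CkW|exact: Dg|exact: CkW|exact: Df].
Qed.

Lemma CkN k f : Ck k f -> Ck k (fun z => - f z).
Proof.
move=> Cf; have -> : (fun z => - f z) = (fun z => -1 * f z).
  by apply/funext => z; rewrite mulN1r.
by apply: CkM => //; exact: Ck_cst.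
Qed.

Lemma CkB k f g : Ck k f -> Ck k g -> Ck k (fun z => f z - g z).
Proof. by move=> Cf Cg; apply: CkD => //; exact: CkN. Qed.

Lemma Ck_sum k n (f : 'I_n -> V -> R) :
  (forall i, Ck k (f i)) -> Ck k (fun z => \sum_i f i z).
Proof.
move=> Cf; elim: n f Cf => [f _|n IH f Cf].
  have -> : (fun z => \sum_i f i z) = (fun=> 0).
    by apply/funext => z; rewrite big_ord0.
  exact: Ck_cst.
have -> : (fun z => \sum_i f i z) =
    (fun z => f ord0 z + \sum_i f (lift ord0 i) z).
  by apply/funext => z; rewrite big_ord_recl.
by apply: CkD => //; exact: IH.
Qed.

End Ck.

Section paraboloid.
Context {R : realType} {n : nat}.

Lemma Ck_fst k : Ck k (fun z : R * 'rV[R]_n => z.1).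
Proof.
have lin : linear (fun z : R * 'rV[R]_n => z.1) by [].
pose f : {linear (R * 'rV[R]_n)%type -> R} :=
  HB.pack (fun z : R * 'rV[R]_n => z.1) (GRing.isLinear.Build _ _ _ _ _ lin).
apply: (@Ck_linear _ _ k f) => z; exact: cvg_fst.
Qed.

Lemma Ck_snd_coord k (i : 'I_n) : Ck k (fun z : R * 'rV[R]_n => z.2 0 i).
Proof.
have lin : linear (fun z : R * 'rV[R]_n => z.2 0 i).
  by move=> a y z; rewrite /= !mxE.
pose f : {linear (R * 'rV[R]_n)%type -> R} :=
  HB.pack (fun z : R * 'rV[R]_n => z.2 0 i) (GRing.isLinear.Build _ _ _ _ _ lin).
apply: (@Ck_linear _ _ k f) => z.
apply: (@continuous_comp _ _ _ snd (fun x : 'rV[R]_n => x 0 i)).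
  exact: cvg_snd.
exact: coord_continuous.
Qed.

Lemma Ck_dot k (f g : R * 'rV[R]_n -> 'rV[R]_n) :
  (forall i, Ck k (fun z => f z 0 i)) -> (forall i, Ck k (fun z => g z 0 i)) ->
  Ck k (fun z => dot (f z) (g z)).
Proof. by move=> Cf Cg; apply: Ck_sum => i; exact: CkM. Qed.

(** Its first-order data at the centre are a and p whatever C is; C leaves room to absorb quadratic
    remainders of either sign. *)
Definition paraboloid (t0 : R) (x0 : 'rV[R]_n) (a : R) (p : 'rV[R]_n) (C : R)
    (z : R * 'rV[R]_n) : R :=
  a * (z.1 - t0) + dot (z.2 - x0) p
  + C * ((z.1 - t0) * (z.1 - t0) + dot (z.2 - x0) (z.2 - x0)).

Lemma smooth_paraboloid t0 x0 a p C : smooth (paraboloid t0 x0 a p C).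
Proof.
move=> k.
have Ct : Ck k (fun z : R * 'rV[R]_n => z.1 - t0).
  by apply: CkB; [exact: Ck_fst|exact: Ck_cst].
have Cx i : Ck k (fun z : R * 'rV[R]_n => (z.2 - x0) 0 i).
  have -> : (fun z : R * 'rV[R]_n => (z.2 - x0) 0 i) = (fun z => z.2 0 i - x0 0 i).
    by apply/funext => z; rewrite !mxE.
  by apply: CkB; [exact: Ck_snd_coord|exact: Ck_cst].
apply: CkD; first apply: CkD.
- by apply: CkM => //; exact: Ck_cst.
- by apply: Ck_dot => // i; exact: Ck_cst.
apply: CkM; first exact: Ck_cst.
by apply: CkD; [exact: CkM|exact: Ck_dot].
Qed.

Lemma derive_quadratic (V : normedModType R) (f : V -> R) (x v : V) (l c : R) :
  (forall h : R, f (h *: v + x) - f x = h * l + h ^+ 2 * c) -> 'D_v f x = l.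
Proof.
move=> fE; apply: cvg_lim => //.
have E : {near 0^', (fun h : R => l + h * c) =1
    (fun h : R => h^-1 *: ((f \o shift x) (h *: v) - f x))}.
  near=> h; have h0 : h != 0 by near: h; exact: nbhs_dnbhs_neq.
  by rewrite /= fE /GRing.scale /= mulrDr mulrA mulVf// mul1r expr2 -mulrA mulKf.
apply: cvg_trans (near_eq_cvg E) _.
have : (fun h : R => l + h * c) @ 0 --> l + 0 * c.
  by apply: cvgD; [exact: cvg_cst|apply: cvgM; [exact: cvg_id|exact: cvg_cst]].
rewrite mul0r addr0; exact: cvg_within_filter.
Unshelve. all: by end_near. Qed.

Lemma derive1_paraboloid t0 x0 a p C :
  derive1 (fun t => paraboloid t0 x0 a p C (t, x0)) t0 = a.
Proof.
rewrite derive1E; apply: (@derive_quadratic R^o _ _ _ _ C) => h.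
rewrite /paraboloid /= !subrr dot0l [h%:A]mulr1 addrK; ring.
Qed.

Lemma grad_paraboloid t0 x0 a p C :
  grad (fun x => paraboloid t0 x0 a p C (t0, x)) x0 = p.
Proof.
apply/rowP => i; rewrite mxE.
apply: (@derive_quadratic _ _ _ _ _ (C * dot (delta_mx 0 i) (delta_mx 0 i))) => h.
rewrite /paraboloid /= !subrr addrK !(dotZl, dotZr) (dot_delta i p) !dot0l; ring.
Qed.

End paraboloid.

(** * Viscosity inequalities in terms of one-sided quadratic bounds *)

Section jets.
Context {R : realType} {n : nat}.
Variables (T : R).
Implicit Types (F : 'rV[R]_n -> R) (u : R * 'rV[R]_n -> R).

(** Negating u and the test function swaps maxima and minima. It yields subjets from superjets and
    carries the Hopf-Lax solution over to the backward problem. *)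
Lemma viscosity_solutionN F u :
  viscosity_solution T F u ->
  viscosity_solution T (fun p => - F (- p)) (fun z => - u z).
Proof.
move=> [cu Fu]; split.
  move=> e /cu[d d0 ud]; exists d => // y z Ay Az /(ud _ _ Ay Az).
  by rewrite -opprD normrN.
move=> phi sphi t x tT.
have /Fu/(_ t x tT)/=[Fmax Fmin] : smooth (fun z => - phi z).
  by move=> k; exact: CkN.
have [/(_ (t, x)) dphi _] := sphi 1%N.
have dNphi : differentiable (fun z => - phi z) (t, x) by exact: differentiableN.
have dN w : 'd (fun z => - phi z) (t, x) w = - 'd phi (t, x) w.
  by rewrite diffN.
(* Both partial derivatives of -phi are read off the joint differential, at (1, 0) here and at (0,
   e_i) next. *)
have dt : derive1 (fun t => - phi (t, x)) t = - derive1 (fun t => phi (t, x)) t.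
  have := diff_space_time 1 0 dNphi; rewrite dN (diff_space_time _ _ dphi).
  by rewrite !dot0l !addr0 !mul1r.
have dx : grad (fun x => - phi (t, x)) x = - grad (fun x => phi (t, x)) x.
  apply/rowP => i; have := diff_space_time 0 (delta_mx 0 i) dNphi.
  rewrite dN (diff_space_time _ _ dphi) !mul0r !add0r !dot_delta => <-.
  by rewrite [RHS]mxE.
rewrite dt dx in Fmax Fmin.
split=> [umax|umin].
  have /Fmin : local_min (fun z => u z - - phi z) (t, x).
    move: umax; apply: filterS => z /=; lra.
  lra.
have /Fmax : local_max (fun z => u z - - phi z) (t, x).
  move: umin; apply: filterS => z /=; lra.
lra.
Qed.

Lemma viscosity_superjet F u (t : R) (x : 'rV[R]_n) (a : R) (p : 'rV[R]_n) (C : R) :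
  viscosity_solution T F u -> 0 < t < T ->
  (\forall z \near (t, x), u z <= u (t, x) + paraboloid t x a p C z) ->
  a + F p <= 0.
Proof.
move=> [_ Fu] tT uz.
have [+ _] := Fu _ (smooth_paraboloid t x a p C) t x tT.
rewrite derive1_paraboloid grad_paraboloid; apply.
have p0 : paraboloid t x a p C (t, x) = 0.
  by rewrite /paraboloid /= !subrr !dot0l; ring.
by move: uz; apply: filterS => z /=; rewrite p0; lra.
Qed.

Lemma viscosity_subjet F u (t : R) (x : 'rV[R]_n) (a : R) (p : 'rV[R]_n) (C : R) :
  viscosity_solution T F u -> 0 < t < T ->
  (\forall z \near (t, x), u (t, x) + paraboloid t x a p C z <= u z) ->
  0 <= a + F p.
Proof.
move=> /viscosity_solutionN Fu tT uz.
have Nuz : \forall z \near (t, x), - u z <=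
    - u (t, x) + paraboloid t x (- a) (- p) (- C) z.
  by move: uz; apply: filterS => z; rewrite /paraboloid dotNr; lra.
have := viscosity_superjet Fu tT Nuz.
by rewrite opprK; lra.
Qed.

End jets.

(** * Comparison by doubling of variables *)

Section continuity.
Context {R : realType}.

Lemma unif_continuous_on_continuous (V : normedModType R) (f : V -> R) :
  unif_continuous_on setT f -> continuous f.
Proof.
move=> uf x; apply/cvgrPdist_lt => e /uf[d d0 fd].
apply/near_translate; exists d => // h hd; apply: fd => //.
by rewrite opprD addrA subrr sub0r normrN.
Qed.

(** Cut the segment from y to z into pieces of length at most d / 2: f moves by at most 1 along
    each, so the increment is bounded by the number of pieces. *)
Lemma unif_continuous_growth (V : normedModType R) (f : V -> R) :
  unif_continuous_on setT f ->
  exists2 C : R, 0 < C & forall y z, `|f y - f z| <= C * (1 + `|y - z|).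
Proof.
move=> /(_ 1 ltr01)[d d0 fd].
have d2 : 0 < d / 2 by rewrite divr_gt0.
have chain (k : nat) : forall y z : V, `|y - z| <= k%:R * (d / 2) -> `|f y - f z| <= k%:R.
  elim: k => [y z|k IH y z yz].
    by rewrite mul0r normr_le0 subr_eq0 => /eqP ->; rewrite subrr normr0.
  have k0 : 0 < k.+1%:R :> R by rewrite ltr0n.
  pose a : R := k.+1%:R^-1.
  have a0 : 0 < a by rewrite invr_gt0.
  have ak : a * k.+1%:R = 1 by rewrite mulVf// gt_eqF.
  clearbody a; pose w := y - a *: (y - z).
  have := ler_wpM2l (ltW a0) yz; rewrite (mulrA a) ak mul1r => ayz.
  have yw : `|y - w| < d.
    by rewrite /w subKr normrZ gtr0_norm//; lra.
  have wz : `|w - z| <= k%:R * (d / 2).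
    have -> : w - z = (1 - a) *: (y - z) by rewrite scalerBl scale1r /w addrAC.
    have ka : (1 - a) * k.+1%:R = k%:R by rewrite mulrBl ak mul1r -natr1 addrK.
    have a1 : 0 <= 1 - a by rewrite -(pmulr_lge0 _ k0) ka.
    by rewrite normrZ ger0_norm// -ka -mulrA ler_wpM2l.
  have -> : f y - f z = (f y - f w) + (f w - f z) by rewrite addrA subrK.
  rewrite (le_trans (ler_normD _ _))// -natr1 addrC lerD ?IH// ltW//.
  exact: fd.
exists (1 + (d / 2)^-1); first by rewrite addr_gt0// invr_gt0.
move=> y z; set r := `|y - z|.
have r0 : 0 <= r / (d / 2) by apply: divr_ge0; [exact: normr_ge0|exact: ltW].
(* The successor rounds the number of pieces up; this extra piece is covered by the 1 in 1 + |y -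
   z|. *)
have := chain (Num.truncn (r / (d / 2))).+1 y z.
rewrite -ler_pdivrMr// => /(_ (ltW (truncnS_gt _))).
have : (Num.truncn (r / (d / 2)))%:R <= r / (d / 2) by rewrite truncn_le.
rewrite -natr1 mulrDl mul1r mulrDr mulr1 (mulrC _ r).
have := normr_ge0 (y - z); rewrite -/r.
have : 0 <= (d / 2)^-1 by rewrite invr_ge0 ltW.
by lra.
Qed.

Lemma compact_norm_ball n (r : R) : compact [set x : 'rV[R]_n | `|x| <= r].
Proof.
apply: bounded_closed_compact.
  by exists r; split=> [|M rM x /= xr]; [exact: num_real|exact: le_trans xr (ltW rM)].
apply: (@closed_comp _ _ (fun x : 'rV[R]_n => `|x|) [set r' | r' <= r]).
  by move=> x _; exact: norm_continuous.
exact: closed_le.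
Qed.

(** Heine's theorem with only the base point confined to the ball: p + h may leave it. The covering
    form of compactness gives one d for all p at once. *)
Lemma unif_continuous_ball n (F : 'rV[R]_n -> R) (r e : R) :
  continuous F -> 0 < e ->
  exists2 d : R, 0 < d & forall p h, `|p| <= r -> `|h| < d -> `|F (p + h) - F p| < e.
Proof.
move=> cF e0.
have /compact_near_coveringP := @compact_norm_ball n r.
move=> /(_ R (0^'+) (fun d p => forall h, `|h| < d -> `|F (p + h) - F p| < e)) nc.
have /nc : forall p, [set x : 'rV[R]_n | `|x| <= r] p ->
  \forall x \near p & d \near 0^'+, forall h, `|h| < d -> `|F (x + h) - F x| < e.
  move=> p _; have e2 : 0 < e / 2 by rewrite divr_gt0.
  have /cvgrPdist_lt/(_ _ e2)/near_translate[d d0 Fd] := cF p.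
  have d2 : 0 < d / 2 by rewrite divr_gt0.
  have np : \forall x \near p, `|x - p| < d / 2.
    by apply/near_translate; exists (d / 2) => // h; rewrite addrC addKr.
  exists ([set x | `|x - p| < d / 2], [set d' | 0 < d' < d / 2]); first split => /=.
  - exact: np.
  - by near=> d'; apply/andP; split; near: d'; [exact: nbhs_right_gt|exact: nbhs_right_lt].
  move=> [x d'] /= [xp /andP[d'0 d'd]] h hd'.
  have h1 : `|x - p| < d by lra.
  have h2 : `|(x - p) + h| < d by rewrite (le_lt_trans (ler_normD _ _))//; lra.
  have := Fd _ h1; have := Fd _ h2.
  rewrite addrA (addrC p) subrK => f1 f2.
  have -> : F (x + h) - F x = - (F p - F (x + h)) + (F p - F x) by ring.
  by rewrite (le_lt_trans (ler_normD _ _))// normrN; lra.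
move=> H.
have [d [d0 dF]] : exists d : R, 0 < d /\ forall p, `|p| <= r ->
    forall h, `|h| < d -> `|F (p + h) - F p| < e.
  near (0 : R)^'+ => d; exists d; split; first by near: d; exact: nbhs_right_gt.
  by near: d; apply: H.
by exists d => // p h pr hd; exact: dF.
Unshelve. all: by end_near. Qed.

Lemma continuous_dot (T : topologicalType) n (f g : T -> 'rV[R]_n) :
  continuous f -> continuous g -> continuous (fun z => dot (f z) (g z)).
Proof.
move=> cf cg z.
have cM i : (fun z => f z 0 i * g z 0 i) @ z --> f z 0 i * g z 0 i.
  have cc (h : T -> 'rV[R]_n) : continuous h -> (fun z => h z 0 i) @ z --> h z 0 i.
    move=> ch; apply: (@continuous_comp _ _ _ h (fun x : 'rV[R]_n => x 0 i)).
      exact: ch.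
    exact: coord_continuous.
  by apply: cvgM; apply: cc.
have -> : (fun z => dot (f z) (g z)) = \sum_i (fun z => f z 0 i * g z 0 i).
  by apply/funext => w; rewrite fct_sumE.
elim/big_ind: _ => [|a b ca cb|i _]; first exact: cvg_cst.
- exact: (@cvgD _ _ _ _ _ a b).
- exact: cM.
Qed.
End continuity.

(** * The doubled functional: existence, jets and location of its maximum *)

Section doubling.
Context {R : realType} {n : nat}.
Variables (u v : R * 'rV[R]_n -> R) (T t1 k b l G : R).

Definition pospart (x : R) : R := Num.max 0 x.

Lemma pospart_ge0 (x : R) : 0 <= pospart x.
Proof. by rewrite /pospart le_max lexx. Qed.

(** The square of the positive part is C^1 with slope of Lipschitz constant 2, so a parabola with
    leading coefficient 1 touches it from above at every point. *)
Lemma sqr_pospart_le (x s : R) :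
  pospart (x + s) ^+ 2 <= pospart x ^+ 2 + 2 * pospart x * s + s ^+ 2.
Proof.
rewrite /pospart; have s2 := sqr_ge0 s.
have [x0|x0] := leP 0 x; have [y0|y0] := leP 0 (x + s).
- by rewrite !expr2; lra.
- by have := sqr_ge0 (x + s); rewrite !expr2; lra.
- have h : 0 <= (s - (x + s)) * (s + (x + s)) by apply: mulr_ge0; lra.
  by rewrite !expr2 in s2 h *; lra.
- by rewrite !expr2 in s2 *; lra.
Qed.

(* The last term keeps maximum points away from the final time, where a viscosity
   solution satisfies no inequality.  Unlike 1/(T - t) it is finite everywhere, and
   [sqr_pospart_le] bounds it from above by a parabola, as the jets require. *)
Definition doubled (z w : R * 'rV[R]_n) : R :=
  u z - v w - k * ((z.1 - w.1) ^+ 2 + dot (z.2 - w.2) (z.2 - w.2))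
  - b * (dot z.2 z.2 + dot w.2 w.2) - l * (z.1 + w.1)
  - G * (pospart (z.1 - t1) ^+ 2 + pospart (w.1 - t1) ^+ 2).

Lemma doubled_continuous : continuous u -> continuous v ->
  continuous (fun q : (R * 'rV[R]_n) * (R * 'rV[R]_n) => doubled q.1 q.2).
Proof.
move=> cu cv; rewrite /doubled.
have c1 : continuous (fun q : (R * 'rV[R]_n) * (R * 'rV[R]_n) => q.1).
  by move=> q; exact: cvg_fst.
have c2 : continuous (fun q : (R * 'rV[R]_n) * (R * 'rV[R]_n) => q.2).
  by move=> q; exact: cvg_snd.
have f1 : continuous (fun q : R * 'rV[R]_n => q.1).
  by move=> q; exact: cvg_fst.
have f2 : continuous (fun q : R * 'rV[R]_n => q.2).
  by move=> q; exact: cvg_snd.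
have c11 : continuous (fun q : (R * 'rV[R]_n) * (R * 'rV[R]_n) => q.1.1).
  by move=> q; apply: continuous_comp; [exact: c1|exact: f1].
have c12 : continuous (fun q : (R * 'rV[R]_n) * (R * 'rV[R]_n) => q.1.2).
  by move=> q; apply: continuous_comp; [exact: c1|exact: f2].
have c21 : continuous (fun q : (R * 'rV[R]_n) * (R * 'rV[R]_n) => q.2.1).
  by move=> q; apply: continuous_comp; [exact: c2|exact: f1].
have c22 : continuous (fun q : (R * 'rV[R]_n) * (R * 'rV[R]_n) => q.2.2).
  by move=> q; apply: continuous_comp; [exact: c2|exact: f2].
have cuq : continuous (fun q : (R * 'rV[R]_n) * (R * 'rV[R]_n) => u q.1).
  by move=> q; apply: continuous_comp; [exact: c1|exact: cu].
have cvq : continuous (fun q : (R * 'rV[R]_n) * (R * 'rV[R]_n) => v q.2).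
  by move=> q; apply: continuous_comp; [exact: c2|exact: cv].
have cX (f : (R * 'rV[R]_n) * (R * 'rV[R]_n) -> R) :
    continuous f -> continuous (fun q => f q ^+ 2).
  move=> cf q; have -> : (fun q => f q ^+ 2) = (fun q => f q * f q).
    by apply/funext => q'; rewrite expr2.
  by apply: cvgM; exact: cf.
have cpos (f : (R * 'rV[R]_n) * (R * 'rV[R]_n) -> R) :
    continuous f -> continuous (fun q => pospart (f q - t1) ^+ 2).
  move=> cf; apply: cX => q; apply: (@continuous_max _ _ (fun=> 0) (fun q => f q - t1)).
    exact: cvg_cst.
  by apply: cvgB; [exact: cf|exact: cvg_cst].
have cdot (f g : (R * 'rV[R]_n) * (R * 'rV[R]_n) -> 'rV[R]_n) :
    continuous f -> continuous g -> continuous (fun z => dot (f z) (g z)).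
  exact: continuous_dot.
move=> q.
apply: cvgB; last first.
  apply: cvgM; first exact: cvg_cst.
  by apply: cvgD; [exact: (cpos _ c11)|exact: (cpos _ c21)].
apply: cvgB; last first.
  apply: cvgM; first exact: cvg_cst.
  by apply: cvgD; [exact: c11|exact: c21].
apply: cvgB; last first.
  apply: cvgM; first exact: cvg_cst.
  by apply: cvgD; [exact: (cdot _ _ c12 c12)|exact: (cdot _ _ c22 c22)].
apply: cvgB; last first.
  apply: cvgM; first exact: cvg_cst.
  apply: cvgD.
    by apply: (cX (fun q => q.1.1 - q.2.1)) => q'; apply: cvgB; [exact: c11|exact: c21].
  have c : continuous (fun q : (R * 'rV[R]_n) * (R * 'rV[R]_n) => q.1.2 - q.2.2).
    by move=> q'; apply: cvgB; [exact: c12|exact: c22].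
  exact: (cdot _ _ c c).
by apply: cvgB; [exact: cuq|exact: cvq].
Qed.

Lemma doubled_attains_max (r : R) : continuous u -> continuous v ->
  0 <= T -> 0 <= r ->
  exists z0 w0, [/\ 0 <= z0.1 <= T, 0 <= w0.1 <= T &
    forall z w : R * 'rV[R]_n, 0 <= z.1 <= T -> 0 <= w.1 <= T ->
      `|z.2| <= r -> `|w.2| <= r -> doubled z w <= doubled z0 w0].
Proof.
move=> cu cv T0 r0.
pose D : set (R * 'rV[R]_n) := `[0, T]%classic `*` [set x | `|x| <= r].
have cD : compact D.
  by apply: compact_setX; [exact: segment_compact|exact: compact_norm_ball].
have D0 : D (0, 0) by split => /=; rewrite ?in_itv/= ?lexx ?T0 ?normr0.
have [||[z0 w0] zw0 zwmax] := @compact_EVT_max _ _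
    (fun q : (R * 'rV[R]_n) * (R * 'rV[R]_n) => doubled q.1 q.2)
    (D `*` D) _ (compact_setX cD cD).
- by exists ((0, 0), (0, 0)).
- by apply: continuous_subspaceT; exact: doubled_continuous.
move: zw0; rewrite inE => -[[/= z0T _] [w0T _]].
exists z0, w0; split; [by move: z0T; rewrite /= ?in_itv|by move: w0T; rewrite /= ?in_itv|].
move=> z w zT wT zr wr; apply: (zwmax (z, w)).
by rewrite inE; split; split; rewrite //= in_itv.
Qed.

Lemma dot_increment (x h : 'rV[R]_n) :
  dot (x + h) (x + h) = dot x x + 2 * dot h x + dot h h.
Proof. by rewrite dotDl !dotDr (dotC x h); ring. Qed.

Hypotheses (k0 : 0 <= k) (b0 : 0 <= b) (G0 : 0 <= G).

Lemma near_slab (t : R) (x : 'rV[R]_n) : 0 < t < T ->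
  \forall z \near (t, x), 0 <= z.1 <= T.
Proof.
move=> /andP[t0 tT]; apply/near_translate; exists (Num.min t (T - t)).
  by rewrite lt_min t0 subr_gt0.
move=> [s h]; rewrite norm_pair_lt => /andP[+ _].
by rewrite lt_min !ltr_norml /= => /andP[/andP[? ?] /andP[? ?]]; apply/andP; split; lra.
Qed.

Lemma doubled_max_fst F (t s : R) (x y : 'rV[R]_n) :
  viscosity_solution T F u -> 0 < t < T ->
  (forall z : R * 'rV[R]_n, 0 <= z.1 <= T -> doubled z (s, y) <= doubled (t, x) (s, y)) ->
  2 * k * (t - s) + l + 2 * G * pospart (t - t1)
    + F ((2 * k) *: (x - y) + (2 * b) *: x) <= 0.
Proof.
(* With the second point frozen, u lies below its value plus the increment of the penalties. The
   coupling, the localisation and the final-time term contribute at most k, b and G to the quadratic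
   part. *)
move=> Fu tT Hmax; apply: (viscosity_superjet (C := k + b + G) Fu tT).
apply: filterS (near_slab x tT) => -[t' x'] /Hmax.
set sg := t' - t; set h := x' - x.
have -> : t' = t + sg by rewrite /sg; ring.
have -> : x' = x + h by rewrite addrC subrK.
rewrite /doubled /paraboloid /= !(addrAC _ _ (- t)) !(addrAC _ _ (- x)) !subrr !add0r.
have -> : t + sg - s = (t - s) + sg by ring.
have -> : t + sg - t1 = (t - t1) + sg by ring.
have -> : x + h - y = (x - y) + h by rewrite addrAC.
clearbody h sg; rewrite (dot_increment (x - y)) (dot_increment x h).
rewrite (dotDr ((2 * k) *: _)) !dotZr.
have := ler_wpM2l G0 (sqr_pospart_le (t - t1) sg).
have := mulr_ge0 k0 (sqr_ge0 sg); have := mulr_ge0 b0 (sqr_ge0 sg).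
have := mulr_ge0 G0 (dot_ge0 h).
move: (dot h h) (dot h x) (dot (x - y) (x - y)) (dot x x) (dot h (x - y)) => d1 d2 d3 d4 d5.
move: (pospart _) (pospart _) (pospart _) => p1 p2 p3.
move: (u _) (u _) (v _) => u1 u2 v1.
rewrite !expr2; lra.
Qed.

(** Since v enters with a minus sign, the coupling contributes the same 2 k (t - s) and 2 k (x - y)
    as in [doubled_max_fst], while l, b and G change sign: subtraction cancels the coupling slope in
    time and leaves 2 l. *)
Lemma doubled_max_snd F (t s : R) (x y : 'rV[R]_n) :
  viscosity_solution T F v -> 0 < s < T ->
  (forall w : R * 'rV[R]_n, 0 <= w.1 <= T -> doubled (t, x) w <= doubled (t, x) (s, y)) ->
  0 <= 2 * k * (t - s) - l - 2 * G * pospart (s - t1)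
    + F ((2 * k) *: (x - y) - (2 * b) *: y).
Proof.
move=> Fv sT Hmax; apply: (viscosity_subjet (C := - (k + b + G)) Fv sT).
apply: filterS (near_slab y sT) => -[t' x'] /Hmax.
set sg := t' - s; set h := x' - y.
have -> : t' = s + sg by rewrite /sg; ring.
have -> : x' = y + h by rewrite addrC subrK.
rewrite /doubled /paraboloid /= !(addrAC _ _ (- s)) !(addrAC _ _ (- y)) !subrr !add0r.
have -> : t - (s + sg) = (t - s) - sg by ring.
have -> : s + sg - t1 = (s - t1) + sg by ring.
have -> : x - (y + h) = (x - y) + - h by rewrite opprD addrA.
clearbody h sg; rewrite (dot_increment (x - y)) (dot_increment y h).
rewrite (dotBr ((2 * k) *: _)) !dotZr !dotNr !dotNl opprK.
have := ler_wpM2l G0 (sqr_pospart_le (s - t1) sg).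
have := mulr_ge0 k0 (sqr_ge0 sg); have := mulr_ge0 b0 (sqr_ge0 sg).
have := mulr_ge0 G0 (dot_ge0 h).
move: (dot h h) (dot h (x - y)) (dot (x - y) (x - y)) (dot x x) (dot y y) (dot h y).
move=> d1 d2 d3 d4 d5 d6.
move: (pospart _) (pospart _) (pospart _) => p1 p2 p3.
move: (v _) (v _) (u _) => u1 u2 v1.
rewrite !expr2; lra.
Qed.

Variables (A m : R).
Hypotheses (k1 : 1 <= k) (b_gt0 : 0 < b) (l0 : 0 <= l) (A0 : 0 < A) (m0 : 0 < m).
Hypothesis uvA : forall (t s : R) (x y : 'rV[R]_n),
  0 <= t <= T -> 0 <= s <= T -> u (t, x) - v (s, y) <= A * (1 + `|x - y|).

(** The growth A (1 + r) of u - v, with r = |x - y|, is absorbed by k r^2 >= r^2 at the cost of A^2,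
    because A r - r^2 <= A^2. *)
Lemma doubled_le (z w : R * 'rV[R]_n) : 0 <= z.1 <= T -> 0 <= w.1 <= T ->
  doubled z w <= A + A ^+ 2 - b * (`|z.2| ^+ 2 + `|w.2| ^+ 2)
                 - G * (pospart (z.1 - t1) ^+ 2 + pospart (w.1 - t1) ^+ 2).
Proof.
case: z w => [t x] [s y] /= /[dup] tT /andP[t0 _] /[dup] sT /andP[s0 _].
rewrite /doubled /=; have := uvA x y tT sT.
have := ler_wpM2l k0 (sqr_normr_le_dot (x - y)).
have := ler_wpM2l b0 (sqr_normr_le_dot x).
have := ler_wpM2l b0 (sqr_normr_le_dot y).
have := mulr_ge0 k0 (sqr_ge0 (t - s)).
have := mulr_ge0 l0 (addr_ge0 t0 s0).
set r := `|x - y|.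
have := mulr_ge0 (_ : 0 <= k - 1) (sqr_ge0 r); rewrite subr_ge0 => /(_ k1).
have := sqr_ge0 (A - r); have := sqr_ge0 A; have := sqr_ge0 r.
rewrite !expr2; lra.
Qed.

Hypothesis T0 : 0 <= T.

(** Outside a large ball the b-penalty makes the functional nonpositive, whereas its value at (t, x)
    is at least m > 0; a maximum over the ball is therefore global. *)
Lemma doubled_has_max (t : R) (x : 'rV[R]_n) : continuous u -> continuous v ->
  0 <= t <= T -> m <= doubled (t, x) (t, x) ->
  exists t0 x0 s0 y0, [/\ 0 <= t0 <= T, 0 <= s0 <= T,
    m <= doubled (t0, x0) (s0, y0) &
    forall z w : R * 'rV[R]_n, 0 <= z.1 <= T -> 0 <= w.1 <= T ->
      doubled z w <= doubled (t0, x0) (s0, y0)].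
Proof.
move=> cu cv tT dbl1.
(* The first term puts the competitor x inside the ball, the 1 gives r <= r^2, and the last term
   gives b r >= A + A^2. *)
pose r := `|x| + 1 + (A + A ^+ 2) / b.
have AA : 0 <= (A + A ^+ 2) / b by rewrite divr_ge0// addr_ge0 ?sqr_ge0// ltW.
have nx := normr_ge0 x.
have r1 : 1 <= r by rewrite /r -addrA addrCA lerDl addr_ge0.
have rx : `|x| <= r by rewrite /r -addrA lerDl addr_ge0.
have br : A + A ^+ 2 <= b * r.
  have -> : A + A ^+ 2 = b * ((A + A ^+ 2) / b) by rewrite mulrC divfK// gt_eqF.
  by rewrite ler_wpM2l// /r lerDr addr_ge0.
clearbody r.
have far (y : 'rV[R]_n) : r < `|y| -> A + A ^+ 2 <= b * `|y| ^+ 2.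
  move=> /ltW ry; apply: (le_trans br); rewrite ler_wpM2l// (le_trans ry)//.
  by rewrite expr2 ler_peMr// (le_trans r1).
have [[t0 x0] [[s0 y0] [/= t0T s0T Hr]]] :=
  doubled_attains_max cu cv T0 (le_trans ler01 r1).
have dbl0 := le_trans dbl1 (Hr (t, x) (t, x) tT tT rx rx).
exists t0, x0, s0, y0; split=> // z w zT wT.
have bz := mulr_ge0 b0 (sqr_ge0 `|z.2|); have bw := mulr_ge0 b0 (sqr_ge0 `|w.2|).
have small : A + A ^+ 2 <= b * (`|z.2| ^+ 2 + `|w.2| ^+ 2) ->
    doubled z w <= doubled (t0, x0) (s0, y0).
  move=> Ab; apply: le_trans dbl0; apply: le_trans (ltW m0).
  have := doubled_le zT wT.
  have := mulr_ge0 G0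
    (addr_ge0 (sqr_ge0 (pospart (z.1 - t1))) (sqr_ge0 (pospart (w.1 - t1)))).
  lra.
rewrite mulrDr in small.
have [zr|/far zr] := leP `|z.2| r; last by apply: small; rewrite (le_trans zr)// lerDl.
have [wr|/far wr] := leP `|w.2| r; last by apply: small; rewrite (le_trans wr)// lerDr.
exact: Hr.
Qed.

Hypothesis GA : A + A ^+ 2 <= G * pospart (T - t1) ^+ 2.

(** At time T the G-penalty already exceeds the bound of [doubled_le], so a value m > 0 forces both
    times below T. For the rest, m plus the k- and b-penalties is at most A (1 + q) with q = |x -
    y|; since q^2 <= k q^2, this forces q <= A + 1, and the right side becomes A (A + 2). *)
Lemma doubled_max_estimates (t s : R) (x y : 'rV[R]_n) :
  0 <= t <= T -> 0 <= s <= T -> m <= doubled (t, x) (s, y) ->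
  [/\ t < T, s < T, m <= u (t, x) - v (s, y), `|x - y| <= A + 1 &
      k * ((t - s) ^+ 2 + `|x - y| ^+ 2) + b * (`|x| ^+ 2 + `|y| ^+ 2)
      <= A * (A + 2)].
Proof.
move=> tT sT dbl0.
have bpos : 0 <= b * (`|x| ^+ 2 + `|y| ^+ 2) by rewrite mulr_ge0// addr_ge0 ?sqr_ge0.
have g1 := mulr_ge0 G0 (sqr_ge0 (pospart (t - t1))).
have g2 := mulr_ge0 G0 (sqr_ge0 (pospart (s - t1))).
have := @doubled_le (t, x) (s, y) tT sT; rewrite /= => dle.
have m0' := m0; have GA' := GA.
have tT' : t < T.
  rewrite lt_neqAle; case/andP: (tT) => _ ->; rewrite andbT; apply/eqP => tE.
  by rewrite -tE in GA'; lra.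
have sT' : s < T.
  rewrite lt_neqAle; case/andP: (sT) => _ ->; rewrite andbT; apply/eqP => sE.
  by rewrite -sE in GA'; lra.
have /andP[t0 _] := tT; have /andP[s0 _] := sT.
have uvM : m + k * ((t - s) ^+ 2 + `|x - y| ^+ 2) + b * (`|x| ^+ 2 + `|y| ^+ 2)
    <= u (t, x) - v (s, y).
  move: dbl0; rewrite /doubled /=.
  have := ler_wpM2l k0 (sqr_normr_le_dot (x - y)).
  have := ler_wpM2l b0 (sqr_normr_le_dot x).
  have := ler_wpM2l b0 (sqr_normr_le_dot y).
  have := mulr_ge0 l0 (addr_ge0 t0 s0).
  clear dle; lra.
have := uvA x y tT sT; clear dle dbl0 g1 g2 GA'.
set q := `|x - y| in uvM *; have q0 : 0 <= q by exact: normr_ge0.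
clearbody q => uvq.
have kq : q ^+ 2 <= k * q ^+ 2 by rewrite ler_peMl ?sqr_ge0.
have kt : 0 <= k * (t - s) ^+ 2 by rewrite mulr_ge0 ?sqr_ge0.
have kq0 : 0 <= k * q ^+ 2 by rewrite mulr_ge0 ?sqr_ge0.
have A0' := A0.
have qA : q <= A + 1.
  rewrite leNgt; apply/negP => Aq.
  have qA0 : 0 < q - (A + 1) by rewrite subr_gt0.
  have qpos : 0 < q by lra.
  have := mulr_gt0 qA0 qpos; move: kq uvM kt bpos.
  by rewrite (expr2 q); lra.
have Aq : A * (1 + q) <= A * (A + 2) by rewrite ler_wpM2l ?(ltW A0)//; lra.
split=> //; lra.
Qed.

End doubling.

(** * Comparison before the final time *)

Section comparison_unif_continuous.
Context {R : realType} {n : nat}.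
Variables (T : R) (F : 'rV[R]_n -> R) (u v : R * 'rV[R]_n -> R).
Hypotheses (Fu : viscosity_solution T F u) (Fv : viscosity_solution T F v).
Hypotheses (uu : unif_continuous_on setT u) (uv : unif_continuous_on setT v).
Hypothesis uv0 : forall x, u (0, x) <= v (0, x).

(** Pass through time 0, where u <= v at the point x: the two remaining increments cover a bounded
    time and the distance from x to y only. *)
Lemma cross_growth : 0 < T ->
  exists2 A : R, 0 < A & forall (t s : R) (x y : 'rV[R]_n),
    0 <= t <= T -> 0 <= s <= T -> u (t, x) - v (s, y) <= A * (1 + `|x - y|).
Proof.
move=> T0; have [Cu Cu0 uC] := unif_continuous_growth uu.
have [Cv Cv0 vC] := unif_continuous_growth uv.
exists ((Cu + Cv) * (1 + T)); first by rewrite mulr_gt0 ?addr_gt0.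
move=> t s x y /andP[t0 tT] /andP[s0 sT].
have := uC (t, x) (0, x); have := vC (0, x) (s, y); have := uv0 x.
rewrite -[(t, x) - _]/(t - 0, x - x) -[(0, x) - _]/(0 - s, x - y) subrr subr0 sub0r.
have h1 : `|(t, 0 : 'rV[R]_n)| <= T by rewrite norm_pair_le normr0 ger0_norm// tT ltW.
have xy0 := normr_ge0 (x - y).
have h2 : `|(- s, x - y)| <= T + `|x - y|.
  by rewrite norm_pair_le normrN ger0_norm//; apply/andP; split; lra.
have h3 := ler_wpM2l (ltW Cu0) h1.
have h4 := ler_wpM2l (ltW Cv0) h2.
have h5 : 0 <= (Cu + Cv) * T * `|x - y| by rewrite !mulr_ge0// ?addr_ge0// ltW.
have h6 : 0 <= Cu * `|x - y| by rewrite mulr_ge0// ltW.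
rewrite !ler_norml => h7 /andP[_ h8] /andP[_ h9].
lra.
Qed.

(** If one of the times were 0, the initial ordering and the modulus of the other function would
    give u - v < m. *)
Lemma interior_of_close (m eta t s : R) (x y : 'rV[R]_n) :
  (forall y z : R * 'rV[R]_n, `|y - z| < eta -> `|u y - u z| < m /\ `|v y - v z| < m) ->
  `|t - s| < eta -> `|x - y| < eta -> 0 <= t -> 0 <= s ->
  m <= u (t, x) - v (s, y) -> 0 < t /\ 0 < s.
Proof.
move=> eta_uv ts xy t0 s0 uvm; split; rewrite lt_neqAle ?t0 ?s0 andbT; apply/eqP => E.
  have [_] : `|u (0, x) - u (s, y)| < m /\ `|v (0, x) - v (s, y)| < m.
    by apply: eta_uv; rewrite E norm_pair_lt ts.
  by rewrite ltr_norml => /andP[_]; have := uv0 x; rewrite -E in uvm; lra.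
have [+ _] : `|u (t, x) - u (0, y)| < m /\ `|v (t, x) - v (0, y)| < m.
  by apply: eta_uv; rewrite E norm_pair_lt ts.
by rewrite ltr_norml => /andP[_]; have := uv0 y; rewrite -E in uvm; lra.
Qed.

Lemma comparison_unif_continuous (t : R) (x : 'rV[R]_n) :
  continuous F -> 0 <= t < T -> u (t, x) <= v (t, x).
Proof.
move: t x => t1 x1 cF /andP[t10 t1T].
have T0 : 0 < T by lra.
rewrite leNgt; apply/negP => uv1; pose M := u (t1, x1) - v (t1, x1).
have M0 : 0 < M by rewrite subr_gt0.
have ME : u (t1, x1) - v (t1, x1) = M by [].
clearbody M.
have [A A0 uvA] := cross_growth T0.
pose B := A * (A + 2); have B0 : 0 < B by rewrite mulr_gt0// addr_gt0.
have M2 : 0 < M / 2 by rewrite divr_gt0.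
have [eta eta0 uveta] : exists2 eta : R, 0 < eta & forall y z,
    `|y - z| < eta -> `|u y - u z| < M / 2 /\ `|v y - v z| < M / 2.
  have [e1 e10 ue] := uu M2; have [e2 e20 ve] := uv M2.
  exists (Num.min e1 e2); first by rewrite lt_min e10.
  by move=> y z; rewrite lt_min => /andP[h1 h2]; split; [exact: ue|exact: ve].
(* B will bound k times each squared distance at the maximum, so this k forces the two points within
   eta of each other. *)
pose k := 1 + B / eta ^+ 2.
have k1 : 1 <= k by rewrite lerDl divr_ge0 ?sqr_ge0// ltW.
have kB : B < k * eta ^+ 2.
  have e2 : 0 < eta ^+ 2 by rewrite exprn_gt0.
  by rewrite mulrDl mul1r divfK ?gt_eqF// ltrDr.
have k0 : 0 <= k by rewrite (le_trans ler01).
(* At (t1, x1) doubled with itself, the l-penalty is 2 l t1 <= M / 4. The b-penalty will also be at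
   most M / 4, so M / 2 remains. *)
pose l := M / (8 * T); have l0 : 0 < l by rewrite divr_gt0// mulr_gt0.
have lT : l * T = M / 8 by rewrite /l; field; rewrite gt_eqF.
pose G := (A + A ^+ 2) / (T - t1) ^+ 2.
have Tt1 : 0 < (T - t1) ^+ 2 by rewrite exprn_gt0// subr_gt0.
have G0 : 0 <= G by rewrite divr_ge0 ?addr_ge0 ?sqr_ge0// ltW.
have GE : G * (T - t1) ^+ 2 = A + A ^+ 2 by rewrite divfK// gt_eqF.
(* The radius bounds the momentum 2 k (x0 - y0), as |x0 - y0| <= A + 1 at the maximum; tolerance l
   on each side is what the gap 2 l can afford. *)
have [d d0 Fd] := unif_continuous_ball (2 * k * (A + 1)) cF l0.
(* The first bound limits the penalty at x1; the second makes the momentum shifts 2 b x0 and 2 b y0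
   shorter than d, since (2 b |x0|)^2 <= 4 b B < d^2. *)
pose b := Num.min (M / (8 * (1 + dot x1 x1))) (d ^+ 2 / (16 * (B + 1))).
have d2 : 0 < d ^+ 2 by rewrite exprn_gt0.
have x11 : 0 < 1 + dot x1 x1 by have := dot_ge0 x1; lra.
have b0 : 0 < b by rewrite lt_min !divr_gt0// mulr_gt0// ?addr_gt0.
have bx1 : b * dot x1 x1 <= M / 8.
  have : b * (1 + dot x1 x1) <= M / 8.
    by rewrite -ler_pdivlMr// -mulrA -invfM ge_min lexx.
  by lra.
have bB : 16 * (b * B) < d ^+ 2.
  have : b * (16 * (B + 1)) <= d ^+ 2.
    by rewrite -ler_pdivlMr ?mulr_gt0 ?addr_gt0// ge_min lexx orbT.
  by lra.
have BE : B = A * (A + 2) by [].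
clearbody k l G b B.
have dbl1 : M / 2 <= doubled u v t1 k b l G (t1, x1) (t1, x1).
  rewrite /doubled /= ME !subrr dot0l /pospart maxxx expr2 mul0r.
  have := ler_wpM2l (ltW l0) (ltW t1T); lra.
have penT : pospart (T - t1) = T - t1 by rewrite /pospart max_r// subr_ge0 ltW.
have t1T' : 0 <= t1 <= T by rewrite t10 ltW.
have b0' := ltW b0; have l0' := ltW l0.
have GA : A + A ^+ 2 <= G * pospart (T - t1) ^+ 2 by rewrite penT GE.
have [t0 [x0 [s0 [y0 [t0T s0T dbl0 Hmax]]]]] := doubled_has_max k0 b0' G0 k1 b0 l0'
  A0 M2 uvA (ltW T0) (unif_continuous_on_continuous uu) (unif_continuous_on_continuous uv)
  t1T' dbl1.
have [t0T' s0T' uvM2 qA est] :=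
  doubled_max_estimates k0 b0' G0 k1 l0' A0 M2 uvA GA t0T s0T dbl0.
rewrite -BE !mulrDr in est.
have kt0 := mulr_ge0 k0 (sqr_ge0 (t0 - s0)); have kq0 := mulr_ge0 k0 (sqr_ge0 `|x0 - y0|).
have bx0 := mulr_ge0 b0' (sqr_ge0 `|x0|); have by0 := mulr_ge0 b0' (sqr_ge0 `|y0|).
have [ktB kqB bxB byB] : [/\ k * `|t0 - s0| ^+ 2 <= B, k * `|x0 - y0| ^+ 2 <= B,
    b * `|x0| ^+ 2 <= B & b * `|y0| ^+ 2 <= B].
  rewrite real_normK ?num_real//; split; lra.
have near0 (h : R) : 0 <= h -> k * h ^+ 2 <= B -> h < eta.
  move=> h0 kh; have : k * h ^+ 2 < k * eta ^+ 2 by apply: le_lt_trans kB.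
  by rewrite ltr_pM2l ?(lt_le_trans ltr01)// ltr_sqr ?nnegrE// ltW.
have /andP[t00 _] := t0T; have /andP[s00 _] := s0T.
have [t0_gt0 s0_gt0] := interior_of_close uveta (near0 _ (normr_ge0 _) ktB)
  (near0 _ (normr_ge0 _) kqB) t00 s00 uvM2.
have Ju := doubled_max_fst k0 b0' G0 Fu (introT andP (conj t0_gt0 t0T'))
  (fun z zT => Hmax z (s0, y0) zT s0T).
have Jv := doubled_max_snd k0 b0' G0 Fv (introT andP (conj s0_gt0 s0T'))
  (fun w wT => Hmax (t0, x0) w t0T wT).
have bd (x : 'rV[R]_n) : b * `|x| ^+ 2 <= B -> `|(2 * b) *: x| < d.
  move=> bx; rewrite normrZ gtr0_norm ?mulr_gt0//.
  have := ler_wpM2l b0' bx => h.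
  have : (2 * b * `|x|) ^+ 2 < d ^+ 2.
    by move: h bB; rewrite !expr2; have := mulr_gt0 b0 B0; lra.
  by rewrite ltr_sqr ?nnegrE ?mulr_ge0// ltW.
have pq : `|(2 * k) *: (x0 - y0)| <= 2 * k * (A + 1).
  by rewrite normrZ ger0_norm ?mulr_ge0// ler_wpM2l ?mulr_ge0.
have := Fd _ (- ((2 * b) *: y0)) pq; rewrite normrN => /(_ (bd _ byB)) Fy.
have Fx := Fd _ ((2 * b) *: x0) pq (bd _ bxB).
have Gt := mulr_ge0 G0 (pospart_ge0 (t0 - t1)).
have Gs := mulr_ge0 G0 (pospart_ge0 (s0 - t1)).
move: Fx Fy; rewrite !ltr_norml.
(* Subtracting [Jv] from [Ju] bounds 2 l by a difference of two values of F, each closer than l to F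
   (2 k (x0 - y0)). *)
move=> /andP[h1 h2] /andP[h3 h4]; lra.
Qed.

End comparison_unif_continuous.

(** * The operators [Splus] and [Sminus] *)

Section cauchy_problem.
Context {R : realType} {n : nat}.
Variables (T : R).
Hypothesis T0 : 0 < T.
Implicit Types (F : 'rV[R]_n -> R) (u v : R * 'rV[R]_n -> R).

(* Freezing u outside [0, T] makes it uniformly continuous on all of R x R^n. *)
Definition clamp (t : R) : R := Num.max 0 (Num.min t T).

Lemma clamp_itv t : 0 <= clamp t <= T.
Proof. by rewrite /clamp le_max lexx ge_max (ltW T0) ge_min lexx orbT. Qed.

Lemma clamp_id t : 0 <= t <= T -> clamp t = t.
Proof. by move=> /andP[t0 tT]; rewrite /clamp min_l// max_r. Qed.

Lemma clamp_dist t s : `|clamp t - clamp s| <= `|t - s|.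
Proof.
wlog ts : t s / s <= t.
  by move=> W; have [/W//|/ltW/W] := leP s t; rewrite distrC (distrC s).
have T0' := T0.
rewrite (ger0_norm (_ : 0 <= t - s)) ?subr_ge0// /clamp.
have [h1|h1] := leP t T; have [h2|h2] := leP s T;
  have [h3|h3] := leP 0 t; have [h4|h4] := leP 0 s;
  have [h5|h5] := leP 0 T; rewrite ler_norml; apply/andP; split; lra.
Qed.

(** The inequalities are local and tested only at interior times, around which the clamp is the
    identity. *)
Lemma viscosity_solution_clamp F u : viscosity_solution T F u ->
  let u' := fun z : R * 'rV[R]_n => u (clamp z.1, z.2) in
  viscosity_solution T F u' /\ unif_continuous_on setT u'.
Proof.
move=> [uu Fu] u'.
have uu' : unif_continuous_on setT u'.
  move=> e /uu[d d0 ud]; exists d => // -[t x] [s y] _ _ yz.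
  apply: ud; rewrite /slab /= ?clamp_itv//.
  move: yz; rewrite -[(t, x) - _]/(t - s, x - y).
  rewrite -[X in _ -> `|X| < _]/(clamp t - clamp s, x - y) !norm_pair_lt.
  by move=> /andP[ts ->]; rewrite andbT (le_lt_trans (clamp_dist _ _)).
split=> //; split.
  by move=> e /uu'[d d0 ud]; exists d => // y z _ _; exact: ud.
move=> phi sphi t x tT /=; have /=[Fmax Fmin] := Fu phi sphi t x tT.
have u'E : \forall z \near (t, x), u' z = u z.
  by apply: filterS (near_slab x tT) => -[s y] /= sT; rewrite /u' /= clamp_id.
have u'Etx : u' (t, x) = u (t, x).
  by case/andP: tT => t0 tT; rewrite /u' /= clamp_id// !ltW.
have tr (P : R -> R -> Prop) :
    (\forall z \near (t, x), P (u' z - phi z) (u' (t, x) - phi (t, x))) ->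
    \forall z \near (t, x), P (u z - phi z) (u (t, x) - phi (t, x)).
  by apply: filterS2 u'E => z ->; rewrite u'Etx.
split=> h; [apply: Fmax | apply: Fmin].
  exact: (tr (fun a b => a <= b)).
exact: (tr (fun a b => b <= a)).
Qed.

Lemma comparison F u v : continuous F ->
  viscosity_solution T F u -> viscosity_solution T F v ->
  (forall x, u (0, x) <= v (0, x)) -> forall x, u (T, x) <= v (T, x).
Proof.
move=> cF Fu Fv uv0 x.
have [Fu' uu'] := viscosity_solution_clamp Fu.
have [Fv' uv'] := viscosity_solution_clamp Fv.
have T00 : (0 : R) <= 0 <= T by rewrite lexx ltW.
have uv0' y : u (clamp 0, y) <= v (clamp 0, y) by rewrite clamp_id.
have cmp (t : R) : 0 <= t < T -> u (clamp t, x) <= v (clamp t, x).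
  exact: (@comparison_unif_continuous _ _ T F _ _ Fu' Fv' uu' uv' uv0' t x cF).
have TT : 0 <= T <= T by rewrite lexx ltW.
rewrite leNgt; apply/negP => vu.
have e0 : 0 < (u (T, x) - v (T, x)) / 2 by rewrite divr_gt0// subr_gt0.
have [d1 d10 ud] := Fu.1 _ e0; have [d2 d20 vd] := Fv.1 _ e0.
pose d := Num.min T (Num.min d1 d2).
have d0 : 0 < d by rewrite !lt_min T0 d10.
have := lexx d; rewrite {2}/d !le_min => /and3P[dT dd1 dd2]; clearbody d.
(* So close to T, u and v each change by less than half of the supposed gap, which contradicts u <=
   v at time t. *)
pose t := T - d / 2.
have tT : 0 <= t < T by apply/andP; rewrite /t; split; lra.
have tT' : 0 <= t <= T by case/andP: tT => -> /ltW.
have near (y : 'rV[R]_n) (d' : R) : d <= d' -> `|(t, y) - (T, y)| < d'.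
  move=> dd'; rewrite -[(t, y) - _]/(t - T, y - y) norm_pair_lt subrr normr0.
  by apply/andP; split; last lra; rewrite /t ltr_norml; apply/andP; split; lra.
have := cmp t tT; rewrite clamp_id//.
have := ud (t, x) (T, x) tT' TT (near _ _ dd1).
have := vd (t, x) (T, x) tT' TT (near _ _ dd2).
rewrite !ltr_norml => /andP[h1 h2] /andP[h3 h4]; lra.
Qed.

End cauchy_problem.

Section semigroups.
Context {R : realType} {n : nat}.
Variables (T : R) (H L : 'rV[R]_n -> R).
Hypotheses (T0 : 0 < T) (cH : continuous H) (HL : fenchel_pair H L).

Lemma SplusE (u0 : 'rV[R]_n -> R) : lipschitz u0 ->
  Splus T H u0 = fun x => hopf_lax L u0 (T, x).
Proof.
move=> /lipschitzP[K K0 u0K].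
have sol := hopf_lax_viscosity_solution T HL K0 u0K.
rewrite /Splus; set S := [set v | _].
(* The Hopf-Lax trace shows that S is inhabited, so [get] returns an element of S and not its
   default value. *)
have : S (get S).
  apply: (@getI _ S (fun x => hopf_lax L u0 (T, x))).
  by exists (hopf_lax L u0); split => // x; rewrite (hopf_lax0 HL K0 u0K).
move=> [u [Fu uu0 getE]]; apply/funext => x; rewrite getE.
apply/eqP; rewrite eq_le; apply/andP; split.
  by apply: (comparison T0 cH Fu sol) => y; rewrite uu0 (hopf_lax0 HL K0 u0K).
by apply: (comparison T0 cH sol Fu) => y; rewrite uu0 (hopf_lax0 HL K0 u0K).
Qed.

Lemma SminusE (uT : 'rV[R]_n -> R) : lipschitz uT ->
  Sminus T H uT =
  fun x => - hopf_lax (fun q => L (- q)) (fun y => - uT y) (T, x).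
Proof.
move=> /lipschitzP[K K0 uTK].
have NuTK (x y : 'rV[R]_n) : `|- uT x - - uT y| <= K * `|x - y|.
  by rewrite -opprD normrN uTK.
pose u := hopf_lax (fun q => L (- q)) (fun y => - uT y).
have sol : viscosity_solution T (fun p => - H p) (fun z => - u z).
  have := viscosity_solutionN
    (hopf_lax_viscosity_solution T (fenchel_pairN HL) K0 NuTK).
  rewrite (_ : (fun p => - H (- - p)) = fun p => - H p)//.
  by apply/funext => p; rewrite opprK.
have u0E x : u (0, x) = - uT x by rewrite /u (hopf_lax0 (fenchel_pairN HL) K0 NuTK).
have cNH : continuous (fun p => - H p) by move=> p; exact: (continuousN (@cH p)).
rewrite /Sminus; set S := [set v | _].
have : S (get S).
  apply: (@getI _ S (fun x => - u (T, x))).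
  (* The backward notion reverses time once more, so the solution to be checked is -u itself. *)
  exists (fun z => - u (T - z.1, z.2)); split => /=.
  - rewrite /backward_viscosity_solution /=.
    rewrite (_ : (fun z => _) = fun z => - u z)//.
    by apply/funext => -[t x] /=; rewrite subKr.
  - by move=> x; rewrite subrr u0E opprK.
  - by move=> x; rewrite subr0.
move=> [w [Fw wT getE]]; apply/funext => x; rewrite getE.
have := comparison T0 cNH Fw sol; have := comparison T0 cNH sol Fw.
rewrite /= !subr0 !subrr => h1 h2.
apply/eqP; rewrite eq_le; apply/andP; split.
  by apply: h2 => y; rewrite wT u0E opprK.
by apply: h1 => y; rewrite wT u0E opprK.
Qed.

End semigroups.

Lemma lipschitzN (R : realType) (V : normedModType R) (f : V -> R) :
  lipschitz f -> lipschitz (fun x => - f x).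
Proof.
move=> /lipschitzP[K K0 fK]; apply/lipschitzP; exists K => // x y.
by rewrite -opprD normrN fK.
Qed.

Lemma hopf_lax_lipschitz (R : realType) (n : nat) (H L u0 : 'rV[R]_n -> R) (t : R) :
  fenchel_pair H L -> 0 <= t -> lipschitz u0 ->
  lipschitz (fun x => hopf_lax L u0 (t, x)).
Proof.
move=> HL t0 /lipschitzP[K K0 u0K]; apply/lipschitzP; exists K => // x y.
exact: (hopf_lax_space HL K0 u0K).
Qed.

Theorem theorem2p1 (R : realType) (n : nat) (hn : (1 <= n)%N)
    (H : 'rV[R]_n -> R) (H_C2 : Ck 2 H)
    (H_hess : forall p, pos_def (hessian H p))
    (H_super : superlinear H)
    (uT : 'rV[R]_n -> R) (uT_lip : lipschitz uT)
    (T : R) (T_gt0 : 0 < T) :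
  initial_data T H uT !=set0 <-> Splus T H (Sminus T H uT) = uT.
Proof.
have HL : fenchel_pair H (legendre H).
  apply: legendre_fenchel_pair => // p; exists (grad H p) => p'.
  exact: pos_def_hessian_tangent.
have cH : continuous H by exact: (@CkW _ _ 0 H (CkW H_C2)).
have T0 := ltW T_gt0; set L := legendre H in HL.
have SmE := SminusE T_gt0 cH HL uT_lip.
have Sm_lip : lipschitz (Sminus T H uT).
  by rewrite SmE; apply/lipschitzN/(hopf_lax_lipschitz (fenchel_pairN HL))/lipschitzN.
split=> [[u0 [u0_lip u0E]]|SpSm]; last by exists (Sminus T H uT).
have SpE f : lipschitz f -> Splus T H f = fun x => hopf_lax L f (T, x).
  exact: SplusE.
have /lipschitzP[K0 K00 u0K] := u0_lip.
have /lipschitzP[K K_ge0 uTK] := lipschitzN uT_lip.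
have /lipschitzP[K' K'0 SmK] := Sm_lip.
have SmSp x : Sminus T H uT x <= u0 x.
  rewrite SmE lerNl; apply: hopf_lax_ge => q.
  (* Starting from x - T q, the velocity -q has its foot at x, and its cost L(-q) is the one in the
     reflected formula for [Sminus]. *)
  have := hopf_lax_le HL K00 u0K (x - T *: q) (- q) T0.
  rewrite scalerN opprK subrK -[hopf_lax _ _ _]/((fun x => hopf_lax L u0 (T, x)) _).
  by rewrite -SpE// u0E; lra.
rewrite SpE//; apply/funext => x; apply/eqP; rewrite eq_le; apply/andP; split.
  rewrite [leRHS](_ : _ = hopf_lax L u0 (T, x)); last by rewrite -u0E SpE.
  (* Monotonicity of the forward operator: the same q competes in both infima, and only the data
     differ. *)
  apply: hopf_lax_ge => q.
  have := hopf_lax_le HL K'0 SmK x q T0; have := SmSp (x - T *: q); lra.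
apply: hopf_lax_ge => q.
have := hopf_lax_le (fenchel_pairN HL) K_ge0 uTK (x - T *: q) (- q) T0.
have -> : Sminus T H uT (x - T *: q) =
    - hopf_lax (fun q => L (- q)) (fun y => - uT y) (T, x - T *: q) by rewrite SmE.
by move: (hopf_lax _ _ _) => a /=; rewrite scalerN !opprK subrK; lra.
Qed.
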